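(* Let $\mathsf{N}_n$ be a uniformly random simplex tree-child network with $n$ taxa. There exist constants $C,c>0$ such that for all integers $n\ge 1$ and all real $x\ge 0$, $$\mathbb{P}\bigl(\mathrm{H}^-(\mathsf{N}_n)\ge x n^{3/4}\bigr)\ \le\ \mathbb{P}\bigl(\mathrm{H}^+(\mathsf{N}_n)\ge x n^{3/4}\bigr)\ \le\ C e^{-c x^2}.$$
   Context: A simplex tree-child network on a finite set $X$ is a finite directed acyclic graph $N=(V,E)$ with a root $o$ and with leaves bijectively labelled by $X$, such that: the root has (indegree, outdegree) $=(0,1)$; every vertex is reachable from $o$ by a directed path; every leaf has degree $(1,0)$; every vertex that is neither the root nor a leaf is either a tree vertex, of degree $(1,2)$, or a reticulation vertex, of degree $(2,1)$; (tree-child) every non-leaf vertex has at least one child that is a tree vertex or a leaf; (one-component) the unique child of every reticulation vertex is a leaf. Networks are considered up to isomorphism preserving leaf labels. A network with $n$ taxa has leaf label set $[n]=\{1,\dots,n\}$, and $\mathsf{N}_n$ is uniform on the finite set of simplex tree-child networks with $n$ taxa. For a vertex $v$ of $N$, $\mathrm{h}_N^-(v)$ (resp. $\mathrm{h}_N^+(v)$) is the minimal (resp. maximal) number of edges of a directed path from the root to $v$. With $L(N)$ the set of leaves, the longer and shorter heights are $\mathrm{H}^{\pm}(N)=\max_{v\in L(N)}\mathrm{h}_N^{\pm}(v)$. *)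

(* Defs.v *)
From HB Require Import structures.
From mathcomp Require Import all_boot all_order all_algebra.
From mathcomp Require Import generic_quotient.
From mathcomp Require Import reals sequences exp.

Set Implicit Arguments.
Unset Strict Implicit.
Unset Printing Implicit Defensive.

Import GRing.Theory Num.Theory.

Local Open Scope quotient_scope.

(* The arcs form a subset of V * V, so there are no parallel edges. *)
Record net (X V : finType) := Net {
  arcs : {set V * V};
  root : V;
  label : {ffun X -> V}
}.

Section NetFinite.
Variables X V : finType.

Definition net_data (N : net X V) := (arcs N, root N, label N).
Definition data_net (d : {set V * V} * V * {ffun X -> V}) : net X V :=
  let: (a, r, l) := d in Net a r l.

Lemma net_dataK : cancel net_data data_net. Proof. by case. Qed.

HB.instance Definition _ := Finite.copy (net X V) (can_type net_dataK).
End NetFinite.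

Section Network.
Variables X V : finType.
Variable N : net X V.

Definition arc : rel V := fun u v => (u, v) \in arcs N.

Definition indeg (v : V) : nat := #|[set u | arc u v]|.
Definition outdeg (v : V) : nat := #|[set w | arc v w]|.

Definition is_leaf (v : V) : bool := outdeg v == 0.
Definition is_tree_vertex (v : V) : bool := (indeg v == 1) && (outdeg v == 2).
Definition is_reticulation (v : V) : bool := (indeg v == 2) && (outdeg v == 1).

Definition acyclic : bool := [forall u, forall v, arc u v ==> ~~ connect arc v u].

Definition simplex_tree_child : bool :=
  [&& acyclic,
      (indeg (root N) == 0) && (outdeg (root N) == 1),
      [forall v, connect arc (root N) v],
      [forall v, is_leaf v ==> (indeg v == 1)],
      [forall v, (v != root N) && ~~ is_leaf v ==>
                   is_tree_vertex v || is_reticulation v],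
      [forall v, ~~ is_leaf v ==>
                   [exists w, arc v w && (is_tree_vertex w || is_leaf w)]],
      [forall v, is_reticulation v ==> [forall w, arc v w ==> is_leaf w]] &
      injectiveb (label N) && [forall v, is_leaf v == (v \in codom (label N))]].

Definition root_path (k : nat) (v : V) : bool :=
  [exists p : k.-tuple V, path arc (root N) p && (last (root N) p == v)].

(* In an acyclic network a directed path has distinct vertices, hence fewer
   than #|V| edges (see [height_minP] and [height_maxP]). *)
Definition height_min (v : V) : nat :=
  \big[minn/#|V|]_(k < #|V| | root_path k v) k.
Definition height_max (v : V) : nat :=
  \max_(k < #|V| | root_path k v) k.

Definition shorter_height : nat := \max_(v | is_leaf v) height_min v.
Definition longer_height : nat := \max_(v | is_leaf v) height_max v.

End Network.

(* Isomorphism of networks preserving the leaf labels. *)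
Definition net_iso (X V W : finType) (N : net X V) (M : net X W) : bool :=
  [exists f : {ffun V -> W},
    [&& injectiveb f && [forall w, w \in codom f],
        [forall u, forall v, arc M (f u) (f v) == arc N u v],
        f (root N) == root M &
        [forall x, f (label N x) == label M x]]].

Section NetworkFacts.
Variables X V : finType.
Variable N : net X V.
Hypothesis stcN : simplex_tree_child N.

Lemma root_path_lt k v : root_path N k v -> k < #|V|.
Proof.
case/existsP=> p /andP[pathp _].
have /andP[/forallP acN _] := stcN.
suff /card_uniqP cardp : uniq (root N :: p).
  by rewrite -[k](size_tuple p) -[(size p).+1]/(size (root N :: p)) -cardp max_card.
have nocyc u w : arc N u w -> ~~ connect (arc N) w u.
  by move=> uw; have /forallP/(_ w)/implyP := acN u; apply.
elim: (val p) (root N) pathp => [|y q IHq] x //= /andP[xy pathq].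
have := IHq y pathq; rewrite /= => ->; rewrite andbT; apply/negP=> xq; case/negP: (nocyc _ _ xy).
by apply/path_connect: xq.
Qed.

Lemma root_path_ex v : exists k, root_path N k v.
Proof.
have /and3P[_ _ /andP[/forallP/(_ v)/connectP[p pathp ->] _]] := stcN.
by exists (size p); apply/existsP; exists (in_tuple p); rewrite pathp eqxx.
Qed.

Lemma height_minP v :
  root_path N (height_min N v) v /\
  forall k, root_path N k v -> height_min N v <= k.
Proof.
have lb k : root_path N k v -> height_min N v <= k.
  move=> pk; rewrite /height_min -[k]/(val (Ordinal (root_path_lt pk))).
  elim: (index_enum _) (mem_index_enum (Ordinal (root_path_lt pk))) => //= i r IHr.
  rewrite big_cons inE => /predU1P[<- /=|/IHr le_r]; first by rewrite pk geq_minl.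
  by case: ifP => // _; rewrite geq_min le_r orbT.
split=> //; have [k0 pk0] := root_path_ex v.
have := leq_ltn_trans (lb _ pk0) (root_path_lt pk0).
rewrite {1}/height_min; apply: contraTT => npath; rewrite -leqNgt.
move: npath; rewrite /height_min.
elim/big_ind: _ => //= [a b IHa IHb|k pk]; last by rewrite pk.
by rewrite /minn; case: ifP.
Qed.

Lemma height_maxP v :
  root_path N (height_max N v) v /\
  forall k, root_path N k v -> k <= height_max N v.
Proof.
split=> [|k pk]; last first.
  exact: (@leq_bigmax_cond _ _ _ (Ordinal (root_path_lt pk)) pk).
have [k0 pk0] := root_path_ex v.
have [|k pk eqk] := @eq_bigmax_cond _ (fun k : 'I_#|V| => root_path N k v)
  (fun k => k : nat); last by rewrite /height_max eqk.
by apply/card_gt0P; exists (Ordinal (root_path_lt pk0)).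
Qed.

Lemma card_leaves : #|[set v | is_leaf N v]| = #|X|.
Proof.
have /and5P[_ _ _ _ /and4P[_ _ _ /andP[/injectiveP injl /forallP leafP]]] := stcN.
rewrite -(card_codom injl); apply: eq_card => v.
by rewrite inE (eqP (leafP v)).
Qed.

Lemma card_reticulations_le : #|[set v | is_reticulation N v]| <= #|X|.
Proof.
rewrite -card_leaves.
have /and5P[_ _ _ /forallP leaf1 /and4P[_ _ /forallP onec _]] := stcN.
pose f v := odflt v [pick w | arc N v w].
have fP v : is_reticulation N v -> arc N v (f v) /\ is_leaf N (f v).
  move=> rv; have avf : arc N v (f v).
    rewrite /f; case: pickP => //= no.
    case/andP: rv => _; rewrite /outdeg => /cards1P[w /setP/(_ w)].
    by rewrite !inE eqxx no.
  by split=> //; have /implyP/(_ rv)/forallP/(_ (f v))/implyP/(_ avf) := onec v.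
rewrite -(@card_in_imset _ _ f); last first.
  move=> u v; rewrite !inE => /fP[au lu] /fP[av _] fuv.
  have /implyP/(_ lu)/cards1P[w /setP fw] := leaf1 (f u).
  have := fw u; rewrite !inE au => /esym/eqP ->.
  by have := fw v; rewrite !inE fuv av => /esym/eqP ->.
by apply/subset_leq_card/subsetP=> _ /imsetP[v /[!inE] /fP[_ ?] ->].
Qed.

Lemma card_net_le : #|V| <= 4 * #|X|.
Proof.
have /and5P[_ /andP[/eqP ri /eqP ro] _ /forallP leaf1 /andP[/forallP inner _]] := stcN.
have hand : \sum_v indeg N v = \sum_v outdeg N v.
  rewrite /indeg /outdeg.
  under eq_bigr do rewrite cardsE -sum1_card big_mkcond.
  under [RHS]eq_bigr do rewrite cardsE -sum1_card big_mkcond.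
  by rewrite exchange_big.
have cnt (P : pred V) : \sum_v (P v : nat) = #|[set v | P v]|.
  by rewrite -sum1_card [RHS]big_mkcond; apply: eq_bigr => v _; rewrite inE; case: (P v).
have local v : indeg N v + (v == root N) + is_tree_vertex N v =
     outdeg N v + is_leaf N v + is_reticulation N v /\
   (v == root N) + is_tree_vertex N v + is_leaf N v + is_reticulation N v = 1.
  have := inner v; have := leaf1 v.
  rewrite /is_leaf /is_tree_vertex /is_reticulation.
  case: (v =P root N) => [->|_] /=; first by rewrite ri ro.
  case: (outdeg N v =P 0) => [->|_] /= => [/eqP -> //|_].
  by case/orP=> /andP[/eqP-> /eqP->].
have e1 : \sum_v (indeg N v + (v == root N) + is_tree_vertex N v) =
  \sum_v (outdeg N v + is_leaf N v + is_reticulation N v).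
  by apply: eq_bigr => v _; case: (local v).
have e2 : \sum_v ((v == root N) + is_tree_vertex N v + is_leaf N v
                  + is_reticulation N v) = #|V|.
  by rewrite -sum1_card; apply: eq_bigr => v _; case: (local v).
have c1 : #|[set v | v == root N]| = 1.
  by rewrite -[RHS](cards1 (root N)); apply: eq_card => v; rewrite !inE.
move: e1 e2; rewrite !big_split /= hand !cnt card_leaves c1 -addnA.
rewrite -[in RHS]addnA => /addnI e1 <-; rewrite e1 -addnA.
have := card_reticulations_le.
set k := #|[set v | is_reticulation N v]|; move=> lek.
have -> : 4 * #|X| = (#|X| + #|X|) + (#|X| + #|X|).
  by rewrite !mulSn mul0n addn0 !addnA.
by apply: leq_add; apply: leq_add.
Qed.

End NetworkFacts.

Lemma net_isoP (X V W : finType) (N : net X V) (M : net X W) :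
  reflect (exists f : V -> W,
    [/\ bijective f, forall u v, arc M (f u) (f v) = arc N u v,
        f (root N) = root M & forall x, f (label N x) = label M x])
  (net_iso N M).
Proof.
apply: (iffP existsP) => [[f /and4P[/andP[/injectiveP injf /forallP surj]]]|].
  move=> /forallP af /eqP rf /forallP lf; exists f; split=> //.
  - by exists (fun w => iinv (surj w)) => u; [apply: iinv_f|apply: f_iinv].
  - by move=> u v; have /forallP/(_ v)/eqP := af u.
  - by move=> x; apply/eqP.
case=> f [[g fK gK] af rf lf]; exists [ffun v => f v].
apply/and4P; split.
- apply/andP; split.
    by apply/injectiveP=> u v; rewrite !ffunE; apply: (can_inj fK).
  by apply/forallP=> w; apply/codomP; exists (g w); rewrite ffunE gK.
- by apply/forallP=> u; apply/forallP=> v; rewrite !ffunE af.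
- by rewrite ffunE rf.
- by apply/forallP=> x; rewrite ffunE lf.
Qed.

Lemma net_iso_refl (X V : finType) (N : net X V) : net_iso N N.
Proof. by apply/net_isoP; exists id; split=> //; exists id. Qed.

Lemma net_iso_imp (X V W : finType) (N : net X V) (M : net X W) :
  net_iso N M -> net_iso M N.
Proof.
case/net_isoP=> f [[g fK gK] af rf lf]; apply/net_isoP; exists g; split.
- by exists f.
- by move=> u v; rewrite -af !gK.
- by rewrite -rf fK.
- by move=> x; rewrite -lf fK.
Qed.

Lemma net_iso_comp (X V W Z : finType)
    (N : net X V) (M : net X W) (L : net X Z) :
  net_iso N M -> net_iso M L -> net_iso N L.
Proof.
case/net_isoP=> f [bf af rf lf] /net_isoP[g [bg ag rg lg]].
apply/net_isoP; exists (g \o f); split=> /=; first exact: bij_comp.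
- by move=> u v; rewrite ag af.
- by rewrite rf rg.
- by move=> x; rewrite lf lg.
Qed.

(* The bound on the number of vertices loses nothing, by [card_net_le]. *)
Definition concrete_net (n : nat) : Type :=
  {m : 'I_(4 * n).+1 & {N : net 'I_n 'I_m | simplex_tree_child N}}.
HB.instance Definition _ n := Finite.on (concrete_net n).

Definition concrete_graph n (N : concrete_net n) : net 'I_n 'I_(tag N) :=
  val (tagged N).

Definition concrete_iso n : rel (concrete_net n) :=
  fun N M => net_iso (concrete_graph N) (concrete_graph M).

Lemma concrete_iso_refl n : reflexive (@concrete_iso n).
Proof. by move=> N; apply: net_iso_refl. Qed.
Lemma concrete_iso_sym n : symmetric (@concrete_iso n).
Proof. by move=> N M; apply/idP/idP; apply: net_iso_imp. Qed.
Lemma concrete_iso_trans n : transitive (@concrete_iso n).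
Proof. by move=> M N L; apply: net_iso_comp. Qed.

Canonical concrete_iso_equiv n :=
  EquivRel (@concrete_iso n) (@concrete_iso_refl n)
    (@concrete_iso_sym n) (@concrete_iso_trans n).

(* Simplex tree-child networks with n taxa, up to isomorphism; the taxa
   are 0, ..., n - 1. *)
Definition STCN (n : nat) : Type := {eq_quot (concrete_iso_equiv n)}.
HB.instance Definition _ n := EqQuotient.on (STCN n).
HB.instance Definition _ n := Choice.on (STCN n).
HB.instance Definition _ n : isCountable (STCN n) :=
  CanIsCountable (@reprK _ (STCN n)).
HB.instance Definition _ n : isFinite (STCN n) :=
  CanIsFinite (@reprK _ (STCN n)).

(* The heights of a class are those of an arbitrary representative, which is
   justified by [shorter_height_iso] and [longer_height_iso]. *)
Definition Hminus n (N : STCN n) : nat := shorter_height (concrete_graph (repr N)).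
Definition Hplus n (N : STCN n) : nat := longer_height (concrete_graph (repr N)).

Definition uniform_prob (R : realType) (T : finType) (A : {set T}) : R :=
  (#|A|%:R / #|T|%:R)%R.

Section Invariance.
Variables (X V W : finType) (N : net X V) (M : net X W).
Hypothesis isoNM : net_iso N M.

Lemma heights_iso :
  shorter_height N = shorter_height M /\ longer_height N = longer_height M.
Proof.
case/net_isoP: isoNM => f [bf af rf lf].
have [g fK gK] := bf.
have cVW : #|V| = #|W| := bij_eq_card bf.
have leafE v : is_leaf M (f v) = is_leaf N v.
  rewrite /is_leaf /outdeg -(card_imset _ (can_inj fK)).
  congr (_ == _); apply: eq_card => w; rewrite inE.
  apply/idP/imsetP => [a|[u]]; last by rewrite inE => a ->; rewrite af.
  by exists (g w); rewrite ?gK // inE -af gK.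
  have af' u v : arc N (g u) (g v) = arc M u v by rewrite -af !gK.
  have pathE k v : root_path M k (f v) = root_path N k v.
  apply/existsP/existsP => -[p /andP[pp /eqP lp]].
    exists [tuple of map g p].
    rewrite /= -(fK (root N)) rf last_map lp fK eqxx andbT path_map.
    by rewrite (eq_path (e' := arc M)) // => u w; apply: af'.
  exists [tuple of map f p]; rewrite /= -rf last_map lp eqxx andbT path_map.
  by rewrite (eq_path (e' := arc N)) // => u w; apply: af.
have minE v : height_min M (f v) = height_min N v.
  rewrite /height_min cVW; apply: eq_bigl => k; exact: pathE.
have maxE v : height_max M (f v) = height_max N v.
  rewrite /height_max cVW; apply: eq_bigl => k; exact: pathE.
split; rewrite /shorter_height /longer_height [RHS](reindex f) /=;
  try by [exists g => u _]; by apply: eq_big => v; rewrite ?leafE.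
Qed.

Lemma shorter_height_iso : shorter_height N = shorter_height M.
Proof. by case: heights_iso. Qed.
Lemma longer_height_iso : longer_height N = longer_height M.
Proof. by case: heights_iso. Qed.

End Invariance.

(* Main.v *)
(* Below its root, a simplex tree-child network is a binary tree with leaves in
   J, on the edges of which every other taxon has two attachment points, the
   parents of its reticulation.  Drawn in the plane, each network with |J| = j
   has exactly 2^(j-1) such presentations.  Inserting the leaves and then the
   attachment points one at a time produces every presentation with the same
   multiplicity, so all counts are explicit.

   Heights: in a plane binary tree, the depth of a leaf is its number of left
   turns plus its number of right turns.  The maximal number of left turns is
   the maximum of the Lukasiewicz walk, whose tail is Gaussian by the cycle
   lemma and the reflection principle, without the polynomial factor that a
   union bound over the leaves would cost.  Given the binary tree, the depth of
   a fixed leaf evolves as a Polya urn while attachment points are inserted,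
   and the rising factorial moment of order D bounds its tail by 2^(-D), where
   D is the height of the binary tree; this is small enough for a union bound.
   Finally the law of j is proportional to binom(n, j) / (j-1)!, so that j is of
   order at least sqrt n outside an event of probability e^(-c sqrt n), which
   is negligible because x is at most 4 n^(1/4). *)

Require Import Defs.
From HB Require Import structures.
From mathcomp Require Import all_boot all_order all_algebra.
From mathcomp Require Import generic_quotient.
From mathcomp Require Import reals sequences exp.
From mathcomp Require Import zify ring lra.

Set Implicit Arguments.
Unset Strict Implicit.
Unset Printing Implicit Defensive.

Import Order.TTheory GRing.Theory Num.Theory.
(* [arc] is the arc relation of a network, not [path.arc]. *)
Import Defs.

(** With [j] tree taxa the binary skeleton has [2 j - 1] vertices and the complete drawing
    [2 n - 1], so the urn stretches depths by about [n / j]. A height [x n^(3/4)] thus calls for a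
    skeleton height [h] of order [x j / n^(1/4)], whose Gaussian cost [h^2 / j] is of order
    [x^2 j / sqrt n]. Larger [j] only helps, so the lower tail of [j] is all that has to be
    controlled. The union bound over leaves costs [j 2^(-D)] with [D] of order [h]: here [j] is at
    most a multiple of [h^2], and [h] is at least a multiple of [x^2] because [x] is at most
    [4 n^(1/4)]. Counts stay in [nat] with denominators cleared, and real numbers enter only in the
    last part. *)

(** * Plane presentations of networks *)

(* A network below its root, drawn in the plane: [Lf x] is the leaf [x], [Un y s]
   a tree vertex with one child a reticulation above the leaf [y] and the other
   child drawn as [s], and [Bn l r] a tree vertex without reticulation child. *)
Inductive tree (T : Type) : Type :=
| Lf of T
| Un of T & tree T
| Bn of tree T & tree T.

Fixpoint tree_code (T : Type) (t : tree T) : GenTree.tree T :=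
  match t with
  | Lf x => GenTree.Leaf x
  | Un y s => GenTree.Node 0 [:: GenTree.Leaf y; tree_code s]
  | Bn l r => GenTree.Node 1 [:: tree_code l; tree_code r]
  end.

Fixpoint tree_decode (T : Type) (c : GenTree.tree T) : option (tree T) :=
  match c with
  | GenTree.Leaf x => Some (Lf x)
  | GenTree.Node 0 [:: GenTree.Leaf y; c1] => omap (Un y) (tree_decode c1)
  | GenTree.Node _ [:: c1; c2] =>
      if tree_decode c1 is Some l then omap (Bn l) (tree_decode c2) else None
  | _ => None
  end.

Lemma tree_codeK (T : Type) : pcancel (@tree_code T) (@tree_decode T).
Proof. by elim=> [x|y s /= ->|l /= -> r ->]. Qed.

HB.instance Definition _ (T : choiceType) :=
  Choice.copy (tree T) (pcan_type (@tree_codeK T)).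

(** Families of trees are lists standing for multisets: insertions reach the same tree several
    times, and the counts must divide these multiplicities out. *)
Definition bind (A B : Type) (f : A -> seq B) (G : seq A) : seq B :=
  flatten (map f G).

Lemma big_bind (A B : Type) (f : A -> seq B) (G : seq A) (F : B -> nat) :
  \sum_(t <- bind f G) F t = \sum_(s <- G) \sum_(t <- f s) F t.
Proof. by rewrite /bind big_flatten big_map. Qed.

Lemma count_big (A : Type) (P : pred A) (s : seq A) :
  count P s = \sum_(x <- s) (P x : nat).
Proof. by elim: s => [|x s IHs]; rewrite ?big_nil ?big_cons //= IHs. Qed.

Lemma size_big (A : Type) (s : seq A) : size s = \sum_(x <- s) 1.
Proof. by rewrite sum1_size. Qed.

Section Trees.
Variable T : choiceType.
Implicit Types (s t u l r : tree T) (f g : tree T -> seq (tree T)) (x y z : T).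

Fixpoint leaves t : seq T :=
  match t with
  | Lf x => [:: x] | Un _ s => leaves s | Bn l r => leaves l ++ leaves r
  end.

(** In the drawing of a network a taxon below a reticulation occurs here twice, once for each parent
    of the reticulation. *)
Fixpoint uns t : seq T :=
  match t with
  | Lf _ => [::] | Un y s => y :: uns s | Bn l r => uns l ++ uns r
  end.

(** Each vertex stands for the edge above it, the top edge included, so this is also the number of
    places for an insertion. *)
Fixpoint nnodes t : nat :=
  match t with
  | Lf _ => 1 | Un _ s => (nnodes s).+1 | Bn l r => (nnodes l + nnodes r).+1
  end.

Fixpoint tree_height t : nat :=
  match t with
  | Lf _ => 1 | Un _ s => (tree_height s).+1 | Bn l r => (maxn (tree_height l) (tree_height r)).+1
  end.

Lemma leaves_gt0 t : 0 < size (leaves t).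
Proof. by elim: t => //= l IHl r _; rewrite size_cat ltn_addr. Qed.

Lemma tree_height_gt0 t : 0 < tree_height t. Proof. by case: t. Qed.

Lemma nnodesE t : (nnodes t).+1 = (size (leaves t)).*2 + size (uns t).
Proof.
elim: t => //= [y s IHs|l IHl r IHr]; first by rewrite addnS -IHs.
by rewrite !size_cat; lia.
Qed.

(** [f] acts at the top of a subtree. Insertions and deletions are both of this form, so that one
    adjunction serves reticulations and leaves alike. *)
Fixpoint ins f t : seq (tree T) :=
  f t ++ match t with
         | Lf _ => [::]
         | Un z s => map (Un z) (ins f s)
         | Bn l r => map (fun u => Bn u r) (ins f l) ++ map (Bn l) (ins f r)
         end.

Lemma count_map_inj (h : tree T -> tree T) t (G : seq (tree T)) :
  injective h -> count_mem (h t) (map h G) = count_mem t G.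
Proof.
by move=> injh; rewrite count_map; apply: eq_count => s /=; apply: inj_eq.
Qed.

Lemma count_map0 (h : tree T -> tree T) t (G : seq (tree T)) :
  (forall s, h s != t) -> count_mem t (map h G) = 0.
Proof.
move=> tree_height; rewrite count_map; apply/eqP; rewrite -leqn0 leqNgt -has_count.
by apply/hasPn=> s _ /=; apply: tree_height.
Qed.

(* This turns the multiplicity of a tree among insertions into the number of
   ways to delete a vertex from it. *)
Lemma count_ins_adj f g :
  (forall s t, count_mem t (f s) = count_mem s (g t)) ->
  forall s t, count_mem t (ins f s) = count_mem s (ins g t).
Proof.
move=> fg s t; elim: t s => [x|y t IHt|l IHl r IHr] [x'|y' s|l' r'] /=;
  rewrite !count_cat fg; congr (_ + _); rewrite ?count_cat;
  try by rewrite ?count_map0 //.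
- have [->|ne] := eqVneq y y'.
    by rewrite !count_map_inj //; move=> ? ? [].
  rewrite !count_map0 // => u; apply: contraNneq ne; first by case=> ->.
  by case=> ->.
- congr (_ + _).
    have [->|ne] := eqVneq r r'.
      by rewrite !(count_map_inj (h := fun u => Bn u r')) //; move=> ? ? [].
    rewrite !count_map0 // => u; apply: contraNneq ne; first by case=> _ ->.
    by case=> _ ->.
  have [->|ne] := eqVneq l l'.
    by rewrite !count_map_inj //; move=> ? ? [].
  rewrite !count_map0 // => u; apply: contraNneq ne; first by case=> ->.
  by case=> ->.
Qed.

(** An insertion subdivides the edge above [s]. A leaf may go to either side, whereas a reticulation
    child has no side: only the children of binary vertices are ordered. *)
Definition addU y s := [:: Un y s].
Definition addL y s := [:: Bn (Lf y) s; Bn s (Lf y)].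
Definition cutU y t := if t is Un z s then if z == y then [:: s] else [::] else [::].
Definition cutL y t :=
  if t is Bn l r then
    (if l == Lf y then [:: r] else [::]) ++ (if r == Lf y then [:: l] else [::])
  else [::].

Lemma Un_eq y z s t : (Un y s == Un z t) = (y == z) && (s == t).
Proof. by apply/eqP/andP=> [[-> ->]|[/eqP-> /eqP->]]. Qed.

Lemma Bn_eq s t l r : (Bn s t == Bn l r) = (s == l) && (t == r).
Proof. by apply/eqP/andP=> [[-> ->]|[/eqP-> /eqP->]]. Qed.

Lemma addU_cutU y s t : count_mem t (addU y s) = count_mem s (cutU y t).
Proof.
case: t => [x|z t|l r] //=; rewrite Un_eq [y == z]eq_sym.
by case: eqP => //= _; rewrite eq_sym.
Qed.

Lemma addL_cutL y s t : count_mem t (addL y s) = count_mem s (cutL y t).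
Proof.
case: t => [x|z t|l r] //=.
rewrite !Bn_eq count_cat [Lf y == l]eq_sym [Lf y == r]eq_sym addn0.
congr (_ + _); first by case: eqP => //= _; rewrite eq_sym addn0.
by rewrite andbC; case: eqP => //= _; rewrite eq_sym addn0.
Qed.

Definition insU y := ins (addU y).
Definition insL y := ins (addL y).
Definition delU y := ins (cutU y).
Definition delL y := ins (cutL y).

Lemma count_insU y s t : count_mem t (insU y s) = count_mem s (delU y t).
Proof. exact/count_ins_adj/addU_cutU. Qed.

Lemma count_insL y s t : count_mem t (insL y s) = count_mem s (delL y t).
Proof. exact/count_ins_adj/addL_cutL. Qed.

Lemma mem_insU y s t : (t \in insU y s) = (s \in delU y t).
Proof. by rewrite -!has_pred1 !has_count count_insU. Qed.

Lemma mem_insL y s t : (t \in insL y s) = (s \in delL y t).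
Proof. by rewrite -!has_pred1 !has_count count_insL. Qed.

Lemma size_insL y t : size (insL y t) = (nnodes t).*2.
Proof.
elim: t => //= [z s IHs|l IHl r IHr]; first by rewrite size_map IHs.
by rewrite size_cat !size_map IHl IHr; lia.
Qed.

Lemma size_delU y t : size (delU y t) = count_mem y (uns t).
Proof.
elim: t => //= [z s IHs|l IHl r IHr].
  by rewrite size_cat size_map IHs /cutU; case: eqP.
by rewrite !size_cat !size_map IHl IHr count_cat.
Qed.

(** A leaf is deleted together with its parent, which must be binary. In the absence of unary
    vertices this fails only for the tree reduced to that leaf, hence the correction term. *)
Lemma size_delL y t :
  uns t = [::] -> size (delL y t) + (t == Lf y) = count_mem y (leaves t).
Proof.
have Lf_eq x : (Lf x == Lf y) = (x == y) by apply/eqP/eqP=> [[]|->].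
elim: t => [x _|z s _ |l IHl r IHr] //=; first by rewrite Lf_eq addn0.
case ul: (uns l) => //= ur.
rewrite !size_cat !size_map count_cat -(IHl ul) -(IHr ur).
move: (size (delL y l)) (size (delL y r)) => a b.
by case: (l == _); case: (r == _); rewrite /= ?addn0 ?addn1 ?addSn ?addnS.
Qed.

Lemma delU_Un y z s : delU y (Un z s) =
  (if z == y then [:: s] else [::]) ++ map (Un z) (delU y s).
Proof. by []. Qed.

Lemma delU_Bn y l r : delU y (Bn l r) =
  map (fun u => Bn u r) (delU y l) ++ map (Bn l) (delU y r).
Proof. by []. Qed.

Lemma delL_Bn y l r : delL y (Bn l r) =
  ((if l == Lf y then [:: r] else [::]) ++ (if r == Lf y then [:: l] else [::]))
  ++ map (fun u => Bn u r) (delL y l) ++ map (Bn l) (delL y r).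
Proof. by []. Qed.

Lemma delU_perm y s t :
  s \in delU y t -> leaves s = leaves t /\ perm_eq (y :: uns s) (uns t).
Proof.
elim: t s => [x|z t IHt|l IHl r IHr] s; rewrite ?delU_Un ?delU_Bn //.
  rewrite mem_cat => /orP[|/mapP[u /IHt[lu pu] ->]] /=.
    by case: eqP => // ->; rewrite inE => /eqP->.
  split=> //; rewrite (perm_catCA [:: y] [:: z]) /=.
  by rewrite perm_cons.
rewrite mem_cat => /orP[] /mapP[u uin ->] /=.
  have [-> pu] := IHl u uin; split=> //.
  by rewrite -cat_cons perm_cat2r.
have [-> pu] := IHr u uin; split=> //.
by rewrite (perm_catCA [:: y]) perm_cat2l.
Qed.

Lemma delL_perm y s t :
  s \in delL y t -> perm_eq (y :: leaves s) (leaves t) /\ perm_eq (uns s) (uns t).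
Proof.
elim: t s => [x|z t IHt|l IHl r IHr] s; rewrite ?delL_Bn //.
  by case/mapP=> u /IHt[lu pu] -> /=; rewrite perm_cons.
rewrite !mem_cat => /orP[/orP[]|/orP[] /mapP[u uin ->] /=].
- by case: eqP => // ->; rewrite inE => /eqP->.
- case: eqP => // ->; rewrite inE => /eqP-> /=; rewrite cats0; split=> //.
  by rewrite cats1 perm_sym perm_rcons.
- have [pu qu] := IHl u uin.
  by rewrite -cat_cons !perm_cat2r.
- have [pu qu] := IHr u uin.
  by rewrite (perm_catCA [:: y]) !perm_cat2l.
Qed.

Lemma count_bind_ins f g G t :
  (forall s t, count_mem t (f s) = count_mem s (g t)) ->
  count_mem t (bind (ins f) G) = \sum_(u <- ins g t) count_mem u G.
Proof.
move=> fg; rewrite count_big big_bind.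
under eq_bigr do rewrite -count_big (count_ins_adj fg) count_big.
rewrite exchange_big /=; apply: eq_bigr => u _.
by rewrite count_big; apply: eq_bigr => s _; rewrite eq_sym.
Qed.

Fixpoint genL x xs : seq (tree T) :=
  if xs is y :: ys then bind (insL y) (genL x ys) else [:: Lf x].

Definition genU ys (G : seq (tree T)) : seq (tree T) :=
  foldr (fun y G => bind (insU y) (bind (insU y) G)) G ys.

Lemma sum_const (A : eqType) (F : A -> nat) c (s : seq A) :
  (forall a, a \in s -> F a = c) -> \sum_(a <- s) F a = size s * c.
Proof.
move=> Fc; rewrite big_seq; under eq_bigr do rewrite Fc //.
by rewrite -big_seq big_const_seq count_predT iter_addn_0 mulnC.
Qed.

(** The leaf inserted last can be deleted in exactly one way, so a tree has a single history once
    the order of insertion is fixed. *)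
Lemma count_genL x xs t :
  uniq (x :: xs) -> perm_eq (leaves t) (x :: xs) -> uns t = [::] ->
  count_mem t (genL x xs) = 1.
Proof.
elim: xs t => [|y ys IHys] t uxs pt ut /=.
  case: t pt ut => //= [z|l r].
    by move/perm_small_eq=> /(_ isT)[->]; rewrite eqxx.
  move=> /perm_size; rewrite size_cat /=.
  by have := leaves_gt0 l; have := leaves_gt0 r; lia.
rewrite (count_bind_ins _ _ (addL_cutL y)) (sum_const (c := 1)) ?muln1.
  have := size_delL y ut; rewrite (_ : (t == Lf y) = false).
    rewrite addn0 => ->; rewrite (permP pt) /= eqxx (_ : count_mem y ys = 0).
      by case/andP: uxs => /=; rewrite inE negb_or => /andP[/negbTE->].
    by apply/count_memPn; case/and3P: uxs.
  by apply: contraTF pt => /eqP->; apply/negP=> /perm_size.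
move=> s /delL_perm[ps us]; apply: IHys; last by apply/perm_nilP; rewrite -ut.
  by move: uxs; rewrite /= inE negb_or => /and3P[/andP[_ ->] _ ->].
rewrite -(perm_cons y) (perm_trans ps) // (perm_trans pt) //.
by rewrite (perm_catCA [:: x] [:: y]).
Qed.

Lemma mem_genL x xs t :
  t \in genL x xs -> perm_eq (leaves t) (x :: xs) /\ uns t = [::].
Proof.
elim: xs t => [|y ys IHys] t /=; first by rewrite inE => /eqP->.
case/flatten_mapP=> s /IHys[ps us]; rewrite -/(insL y s) mem_insL.
case/delL_perm=> ps'; rewrite us perm_sym => /perm_nilP ut; split=> //.
rewrite perm_sym in ps'; apply: perm_trans ps' _.
rewrite -(perm_cons y) in ps; apply: perm_trans ps _.
by rewrite (perm_catCA [:: y] [:: x]).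
Qed.

Lemma mem_genU ys G t : t \in genU ys G ->
  exists2 s, s \in G & leaves t = leaves s /\
    perm_eq (uns t) (ys ++ ys ++ uns s).
Proof.
elim: ys t => [|y ys IHys] t /=; first by move=> tG; exists t.
case/flatten_mapP=> u /flatten_mapP[v /IHys[s sG [ls ps]]].
rewrite -!/(insU _ _) !mem_insU => /delU_perm[lv pv] /delU_perm[lu pu].
exists s => //; split; first by rewrite -lu -lv.
rewrite perm_sym in pu; apply: perm_trans pu _; rewrite perm_cons.
rewrite perm_sym in pv; apply: perm_trans pv _.
by rewrite perm_sym (perm_catCA ys [:: y]) /= perm_cons perm_sym.
Qed.

(** The two attachment points of [y] are interchangeable: the first deletion has two choices and the
    second one, which gives a factor 2 per reticulation. *)
Lemma count_genU ys G t c :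
  uniq ys -> perm_eq (uns t) (ys ++ ys) ->
  (forall s, leaves s = leaves t -> uns s = [::] -> count_mem s G = c) ->
  count_mem t (genU ys G) = 2 ^ size ys * c.
Proof.
elim: ys t => [|y ys IHys] t uys pt cG /=.
  by rewrite mul1n cG //; apply: perm_nilP.
have ynot : count_mem y ys = 0 by apply/count_memPn; case/andP: uys.
rewrite (count_bind_ins _ _ (addU_cutU y)).
rewrite (sum_const (c := 2 ^ size ys * c)) => [|s /delU_perm[ls ps]].
  rewrite -/(delU y t) size_delU (permP pt) /= count_cat /= eqxx ynot.
  by rewrite expnS mulnA.
have ps' : perm_eq (uns s) (y :: ys ++ ys).
  rewrite -(perm_cons y) (perm_trans ps) // (perm_trans pt) //= perm_cons.
  by rewrite (perm_catCA ys [:: y]).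
rewrite (count_bind_ins _ _ (addU_cutU y)).
rewrite (sum_const (c := 2 ^ size ys * c)) => [|u /delU_perm[lu pu]].
  rewrite -/(delU y s) size_delU (permP ps') /= count_cat eqxx ynot.
  by rewrite mul1n.
apply: IHys.
- by case/andP: uys.
- by rewrite -(perm_cons y) (perm_trans pu).
- by rewrite lu ls.
Qed.

Lemma sum_genU ys G (F : tree T -> nat) :
  \sum_(t <- genU ys G) F t = \sum_(s <- G) \sum_(t <- genU ys [:: s]) F t.
Proof.
elim: ys F => [|y ys IHys] F /=; first by under [RHS]eq_bigr do rewrite big_seq1.
rewrite !big_bind IHys; apply: eq_bigr => s _.
by rewrite !big_bind.
Qed.

End Trees.

(** * Inserting reticulations: a Polya urn *)

Definition rise (d r : nat) : nat := \prod_(i < r) (d + i).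

Lemma rise0 d : rise d 0 = 1. Proof. by rewrite /rise big_ord0. Qed.

Lemma rise_add d r s : rise d (r + s) = rise d r * rise (d + r) s.
Proof.
rewrite /rise big_split_ord /=; congr (_ * _).
by apply: eq_bigr => i _; rewrite addnA.
Qed.

Lemma rise1 d : rise d 1 = d. Proof. by rewrite /rise big_ord1 addn0. Qed.

Lemma rise_gt0 d r : 0 < d -> 0 < rise d r.
Proof. by move=> d0; apply: prodn_gt0 => i; rewrite addn_gt0 d0. Qed.

Lemma leq_rise d e r : d <= e -> rise d r <= rise e r.
Proof. by move=> de; apply: leq_prod => i _; rewrite leq_add2r. Qed.

Lemma riseS d r : d * rise d.+1 r = rise d r * (d + r).
Proof. by rewrite -addn1 -{1}(rise1 d) -rise_add addnC rise_add rise1. Qed.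

Section Urn.
Variable T : choiceType.
Implicit Types (s t : tree T) (x y : T).

(** For distinct leaf labels, the number of vertices from the top down to the leaf [x], both
    included, and 0 if [x] is no leaf of [t]. At most one summand is then nonzero in the binary
    case. *)
Fixpoint depth x t : nat :=
  match t with
  | Lf z => z == x
  | Un _ s => depth x s + (0 < depth x s)
  | Bn l r => (depth x l + depth x r) + (0 < depth x l + depth x r)
  end.

Lemma depth_notin x t : x \notin leaves t -> depth x t = 0.
Proof.
elim: t => //= [z|y s IHs /IHs-> //|l IHl r IHr].
  by rewrite inE eq_sym => /negbTE->.
by rewrite mem_cat negb_or => /andP[/IHl-> /IHr->].
Qed.

Lemma depth_le_tree_height x t : uniq (leaves t) -> depth x t <= tree_height t.
Proof.
elim: t => //= [z _|y s IHs /IHs|l IHl r IHr]; first by case: eqP.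
  by case: (depth x s) => //= d; rewrite addn1.
rewrite cat_uniq => /and3P[ul /hasPn dis ur].
have := IHl ul; have := IHr ur.
have [xr|/depth_notin->] := boolP (x \in leaves r).
  by rewrite (depth_notin (dis x xr)); lia.
lia.
Qed.

Lemma tree_height_le_depth t : exists2 x, x \in leaves t & tree_height t <= depth x t.
Proof.
elim: t => [x|y s [x xs le]|l [x xl lel] r [y yr ler]] /=.
- by exists x; rewrite ?inE eqxx.
- by exists x => //; have := tree_height_gt0 s; lia.
- have [le|/ltnW le] := leqP (tree_height l) (tree_height r).
    by exists y; rewrite ?mem_cat ?yr ?orbT //; have := tree_height_gt0 r; lia.
  by exists x; rewrite ?mem_cat ?xl //; have := tree_height_gt0 l; lia.
Qed.

(* One step of a Polya urn: among the [nnodes t] insertions, [depth x t] hit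
   the path to the leaf [x]; the identity is written without subtraction. *)
Lemma sum_insU x y t (phi : nat -> nat) :
  \sum_(s <- insU y t) phi (depth x s) + depth x t * phi (depth x t)
  = depth x t * phi (depth x t).+1 + nnodes t * phi (depth x t).
Proof.
elim: t phi => [z|z s IHs|l IHl r IHr] phi; rewrite /insU /=.
- by rewrite big_seq1 /=; case: (z == x); rewrite /= ?mul1n ?mul0n ?add0n ?addn0.
- rewrite big_cons big_map /=.
  have := IHs (fun d => phi (d + (0 < d))); rewrite /= -/(insU y s).
  by case: (depth x s) => [|d] /=; rewrite ?addn0 ?addn1; lia.
- rewrite big_cons big_cat !big_map /=.
  have := IHl (fun d => phi (d + depth x r + (0 < d + depth x r))).
  have := IHr (fun d => phi (depth x l + d + (0 < depth x l + d))).
  rewrite /= -!/(insU y _).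
  case: (depth x l) => [|d]; case: (depth x r) => [|e];
    rewrite /= ?addn0 ?add0n ?addn1 ?addSn ?addnS ?addn0; lia.
Qed.

(** Rising factorials are eigenfunctions of the urn step: by [riseS] the current depth enters the
    result only through [rise (depth x t) r]. *)
Lemma sum_insU_rise x y t r :
  \sum_(s <- insU y t) rise (depth x s) r = rise (depth x t) r * (nnodes t + r).
Proof.
have /= := sum_insU x y t (rise^~ r); rewrite riseS => e.
by apply/eqP; rewrite -(eqn_add2r (depth x t * rise (depth x t) r)) e; apply/eqP; lia.
Qed.

Lemma nnodes_insU y s t : t \in insU y s -> nnodes t = (nnodes s).+1.
Proof.
rewrite mem_insU => /delU_perm[es /perm_size/= eu].
by apply: succn_inj; rewrite nnodesE nnodesE es -eu addnS.
Qed.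

Lemma nnodes_genU ys s t :
  t \in genU ys [:: s] -> nnodes t = nnodes s + (size ys).*2.
Proof.
elim: ys t => [|y ys IHys] t /=; first by rewrite inE addn0 => /eqP->.
case/flatten_mapP=> u /flatten_mapP[v /IHys ev] /nnodes_insU eu /nnodes_insU ->.
by rewrite eu ev; lia.
Qed.

Lemma sum_genU_rise ys s x r :
  \sum_(t <- genU ys [:: s]) rise (depth x t) r
  = rise (depth x s) r * rise (nnodes s + r) (size ys).*2.
Proof.
elim: ys => [|y ys IHys] /=; first by rewrite big_seq1 rise0 muln1.
rewrite !big_bind.
transitivity (\sum_(u <- genU ys [:: s]) rise (depth x u) r *
    ((nnodes s + (size ys).*2 + r) * (nnodes s + (size ys).*2 + r).+1)).
  rewrite !big_seq; apply: eq_bigr => u /nnodes_genU eu.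
  rewrite big_seq; under eq_bigr => v /nnodes_insU ev.
    rewrite sum_insU_rise ev eu; over.
  by rewrite -big_seq -big_distrl /= sum_insU_rise eu mulnA.
rewrite -big_distrl /= IHys -mulnA; congr (_ * _).
rewrite doubleS -addn2 rise_add; congr (_ * _).
rewrite /rise big_ord_recl big_ord1 /= !addn0.
by rewrite /bump /= addn1 addnAC.
Qed.

Lemma size_genU ys s :
  size (genU ys [:: s]) = rise (nnodes s) (size ys).*2.
Proof.
case: (leaves s) (leaves_gt0 s) => // x _ _.
have := sum_genU_rise ys s x 0.
rewrite rise0 mul1n addn0 => <-.
by rewrite size_big; apply: eq_bigr => t _; rewrite rise0.
Qed.

(** It holds factor by factor: [2 * (D + i) <= 4 * D] for [i < D], and [(N + i) * M <= N * (M + i)]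
    because [M <= N]. *)
Lemma rise_halving M N D H :
  0 < M <= N -> 4 * N * D <= M * H ->
  2 ^ D * rise N D * rise D D <= rise M D * rise H D.
Proof.
case/andP=> M0 MN le; have N0 := leq_trans M0 MN.
have -> : 2 ^ D = \prod_(i < D) 2 by rewrite prod_nat_const card_ord.
rewrite /rise -!big_split; apply: leq_prod => i _ /=.
have lti := ltn_ord i.
rewrite -(leq_pmul2l N0).
have e1 : N * (2 * (N + i) * (D + i)) <= (N + i) * (4 * N * D) by nia.
apply: leq_trans e1 _.
have e2 : (N + i) * (4 * N * D) <= (N + i) * (M * H) by rewrite leq_mul2l le orbT.
by apply: leq_trans e2 _; nia.
Qed.

(** Markov's inequality for the rising factorial of order [D] of the depth; each of its [D] factors
    gains 2 by [rise_halving]. *)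
Lemma count_depth_genU ys s x D H :
  let M := nnodes s in let N := M + (size ys).*2 in
  depth x s <= D -> 4 * N * D <= M * H ->
  count (fun t => H <= depth x t) (genU ys [:: s]) * 2 ^ D
    <= rise M (size ys).*2.
Proof.
move=> M N dD le.
have [->|D0] := posnP D.
  by rewrite muln1 (leq_trans (count_size _ _)) // size_genU.
have M0 : 0 < M by rewrite /M; case: (s).
have H0 : 0 < H by case: H le => //; rewrite muln0 leqNgt !muln_gt0 /= D0 /N; lia.
have MN : 0 < M <= N by rewrite M0 leq_addr.
have hv := rise_halving MN le.
rewrite -(leq_pmul2r (rise_gt0 D H0)) -(leq_pmul2r (rise_gt0 D M0)).
have c1 : count (fun t => H <= depth x t) (genU ys [:: s]) * rise H D
   <= rise D D * rise (M + D) (size ys).*2.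
  apply: leq_trans (_ : \sum_(t <- genU ys [:: s]) rise (depth x t) D <= _).
    rewrite count_big big_distrl; apply: leq_sum => t _ /=.
    by case: (leqP H (depth x t)) => // /leq_rise; rewrite mul1n; apply.
  by rewrite sum_genU_rise leq_mul2r leq_rise // orbT.
(* Both sides are [rise M (D + (size ys).*2)], cut at two different places. *)
have e : rise (M + D) (size ys).*2 * rise M D = rise M (size ys).*2 * rise N D.
  by rewrite mulnC -rise_add addnC rise_add.
set c := count _ _ in c1 *; set q := rise M (size ys).*2 in e *.
apply: (@leq_trans (2 ^ D * (rise D D * rise (M + D) (size ys).*2) * rise M D)).
  have := leq_mul (leq_mul (leqnn (2 ^ D)) c1) (leqnn (rise M D)).
  by rewrite [c * _ in X in _ -> X]mulnC !mulnA.
have -> : 2 ^ D * (rise D D * rise (M + D) (size ys).*2) * rise M D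
    = q * (2 ^ D * rise N D * rise D D) by rewrite -!mulnA e; lia.
have -> : q * rise H D * rise M D = q * (rise M D * rise H D) by lia.
by rewrite leq_mul2l hv orbT.
Qed.

End Urn.

(** * Turns and Lukasiewicz words *)

Fixpoint walk_sum (w : seq bool) : int :=
  if w is b :: w' then ((if b then 1 else -1) + walk_sum w')%R else 0%R.

Lemma walk_sum_cat v w : walk_sum (v ++ w) = (walk_sum v + walk_sum w)%R.
Proof. by elim: v => [|b v IHv] /=; rewrite ?add0r // IHv addrA. Qed.

(* Leaves count +1 and binary vertices -1, so [walk_sum] is the opposite of the
   Lukasiewicz walk and the [good] words are those of plane binary trees. *)
Definition good (w : seq bool) : bool :=
  [forall i : 'I_(size w), (walk_sum (take i w) <= 0)%R] && (walk_sum w == 1%R).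

Lemma goodP w : reflect
  ((forall i, i < size w -> (walk_sum (take i w) <= 0)%R) /\ walk_sum w = 1%R) (good w).
Proof.
apply: (iffP andP) => [[/forallP gw /eqP w1]|[gw w1]].
  by split=> // i lti; apply: (gw (Ordinal lti)).
by split; [apply/forallP=> i; apply: gw | apply/eqP].
Qed.

(** Uniqueness in the cycle lemma: for [i > 0] the rotation has the proper prefix [drop i g], whose
    sum is 1 minus a nonpositive number, hence positive. *)
Lemma good_rot0 i g : i < size g -> good g -> good (rot i g) -> i = 0.
Proof.
move=> lti /goodP[gg g1] /goodP[gr _]; apply/eqP; rewrite -leqn0 leqNgt.
apply/negP=> i0.
have := gr (size (drop i g)); rewrite size_rot size_drop => /(_ _)/wrap[].
  by lia.
rewrite /rot take_size_cat ?size_drop //.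
have := gg i lti; have := walk_sum_cat (take i g) (drop i g).
by rewrite cat_take_drop g1; lia.
Qed.

(** Each good word of length [n] accounts for [n] different words. This saves the factor [n] in
    counting good words. *)
Lemma rot_good_inj n (G : seq (seq bool)) :
  uniq G -> {in G, forall g, good g /\ size g = n} ->
  uniq [seq rot i g | g <- G, i <- iota 0 n].
Proof.
move=> uG gG; apply: allpairs_uniq => //; first exact: iota_uniq.
have wl g g' i i' : g \in G -> g' \in G -> i <= i' -> i' < n ->
    rot i g = rot i' g' -> (g, i) = (g', i').
  move=> /gG[gg sg] /gG[gg' sg'] le lt eqr.
  have e : g = rot (i' - i) g'.
    by apply: (can_inj (@rotK i _)); rewrite -rotD ?subnKC // sg'; lia.
  have := @good_rot0 (i' - i) g'; rewrite -e sg' => /(_ _ gg' gg) e0.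
  have {}e0 : i' - i = 0 by apply: e0; lia.
  by rewrite e e0 rot0; congr (_, _); lia.
move=> _ _ /allpairsP[[g i] [/= gin + ->]] /allpairsP[[g' i'] [/= gin' + ->]] /=.
rewrite !mem_iota /= => lti lti' eqr.
have [le|/ltnW le] := leqP i i'; first exact: wl.
by apply/esym/wl.
Qed.

(** [a] is the distance left to a level in direction [b], upwards for [true]; the other letter moves
    away from the level. *)
Fixpoint hit (b : bool) (a : nat) (w : seq bool) {struct w} : bool :=
  match a, w with
  | 0, _ => true
  | _, [::] => false
  | a'.+1, c :: w' => if c == b then hit b a' w' else hit b a'.+2 w'
  end.

Lemma hit_prefix (b : bool) a i w :
  (a%:Z <= (if b then 1 else -1) * walk_sum (take i w))%R -> hit b a w.
Proof.
elim: w a i => [|c w IHw] [|a] i //=; first by rewrite mulr0.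
case: i => [|i] /=; first by rewrite mulr0.
case: eqP => [->|ne] le; apply: (IHw _ i); first by case: (b) le; lia.
by case: (b) (c) ne le => [] []; lia.
Qed.

(* A rotation translates the walk cyclically, so it keeps the oscillation [h] and
   must reach height [h / 2] on one side. *)
Lemma hit_rot g i m h a :
  good g -> i < size g -> m < size g -> (walk_sum (take m g) <= - h%:Z)%R ->
  2 * a <= h -> hit true a (rot i g) || hit false a (rot i g).
Proof.
move=> /goodP[gg g1] lti ltm dip le.
have gi := gg i lti.
have ed : walk_sum (drop i g) = (1 - walk_sum (take i g))%R.
  by have := walk_sum_cat (take i g) (drop i g); rewrite cat_take_drop g1; lia.
have e1 : take (size g - i) (rot i g) = drop i g.
  by rewrite /rot take_size_cat ?size_drop.
(* At position [size g - i] the rotated walk has read [g] to its end and is at height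
   [1 - walk_sum (take i g)]. If this is below [a], the dip lies more than [a] below the new origin,
   whether it is met before or after that position. *)
have [big|small] := leP (Posz a) (1 - walk_sum (take i g))%R.
  by apply/orP; left; apply: (@hit_prefix true _ (size g - i)); rewrite e1 ed mul1r.
apply/orP; right.
have [im|mi] := leqP i m.
  apply: (@hit_prefix false _ (m - i)).
  have -> : take (m - i) (rot i g) = take (m - i) (drop i g).
    by rewrite /rot takel_cat // size_drop; lia.
  rewrite take_drop subnK //.
  have := walk_sum_cat (take i (take m g)) (drop i (take m g)).
  by rewrite cat_take_drop take_takel //; lia.
apply: (@hit_prefix false _ (size g - i + m)).
have -> : take (size g - i + m) (rot i g) = drop i g ++ take m g.
  rewrite /rot -[size g - i]size_drop take_cat ltnNge leq_addr /= addKn.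
  by rewrite take_takel // ltnW.
by rewrite walk_sum_cat ed; lia.
Qed.

Fixpoint binary_words len p : seq (seq bool) :=
  if len is len'.+1 then
    (if p is p'.+1 then map (cons true) (binary_words len' p') else [::])
      ++ map (cons false) (binary_words len' p)
  else if p is 0 then [:: [::]] else [::].

Lemma size_binary_words len p : size (binary_words len p) = 'C(len, p).
Proof.
elim: len p => [|len IH] [|p] //=; first by rewrite size_map IH !bin0.
by rewrite size_cat !size_map !IH addnC binS.
Qed.

Lemma mem_binary_words len p w : (w \in binary_words len p) = (size w == len) && (count id w == p).
Proof.
have consE c c' (s : seq bool) S :
    (c :: s \in map (cons c') S) = (c == c') && (s \in S).
  apply/mapP/andP=> [[u uS [-> ->]]|[/eqP-> sS]]; first by rewrite eqxx.
  by exists s.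
elim: len p w => [|len IH] [|p] [|c w] //=.
- by apply/negbTE/negP => /mapP[].
- by rewrite consE IH; case: c => /=; rewrite ?andbF // andbT.
- by rewrite mem_cat; apply/negbTE/negP => /orP[] /mapP[].
- by rewrite mem_cat !consE !IH; case: c; rewrite /= ?orbF ?add0n.
Qed.

Lemma binary_words_uniq len p : uniq (binary_words len p).
Proof.
have inj c : injective (@cons bool c) by move=> s t [].
elim: len p => [|len IH] [|p] //=; first by rewrite map_inj_uniq.
rewrite cat_uniq !map_inj_uniq // !IH /= andbT.
by apply/hasPn=> _ /mapP[w _ ->]; apply/mapP=> -[].
Qed.

(* The bound is closed under the first-step recursion by Pascal's rule; it is
   what the reflection principle gives when the level [a] is not reached by
   the endpoint. *)
Lemma count_hit b len p q a : p + q = len ->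
  count (hit b a) (binary_words len p) <= 'C(len, (if b then q else p) + a).
Proof.
elim: len p q a => [|len IH] p q a.
  by move/eqP; rewrite addn_eq0 => /andP[/eqP-> /eqP->]; case: a; case: b.
case: a => [|a] pq.
  rewrite (leq_trans (count_size _ _)) // size_binary_words addn0.
  by case: (b); rewrite // -bin_sub -pq ?leq_addr // addKn.
have F : count (hit b a.+1) (map (cons false) (binary_words len p)) <=
    (if q is q'.+1 then
      (if b then 'C(len, q' + a.+2) else 'C(len, p + a)) else 0).
  rewrite count_map; case: q pq => [|q'] pq.
    rewrite (leq_trans (count_size _ _)) // size_binary_words bin_small //; lia.
  have pq' : p + q' = len by lia.
  by case: b IH => IH; apply: IH pq'.
have T : count (hit b a.+1) (if p is p'.+1 then map (cons true) (binary_words len p') else [::])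
    <= (if p is p'.+1 then
      (if b then 'C(len, q + a) else 'C(len, p' + a.+2)) else 0).
  case: p {F} pq => [|p'] pq //; rewrite count_map.
  have pq' : p' + q = len by lia.
  by case: b IH => IH; apply: IH pq'.
rewrite [binary_words _ _]/= count_cat (leq_trans (leq_add T F)) //.
case: b {T F IH}; rewrite addnS binS.
  case: p pq => [|p'] pq; case: q pq => [|q'] pq; rewrite ?addnS ?addSn ?addn0 ?add0n //;
    try lia.
case: p pq => [|p'] pq; case: q pq => [|q'] pq; rewrite ?addnS ?addSn ?addn0 ?add0n //;
    try lia.
Qed.

(** * Plane binary trees as words *)

Section Words.
Variable T : choiceType.
Implicit Types (s t : tree T) (x y : T).

Fixpoint left_height t : nat :=
  match t with
  | Lf _ => 0 | Un _ s => left_height s | Bn l r => maxn (left_height l).+1 (left_height r)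
  end.

Fixpoint right_height t : nat :=
  match t with
  | Lf _ => 0 | Un _ s => right_height s | Bn l r => maxn (right_height l) (right_height r).+1
  end.

Fixpoint mirror t : tree T :=
  match t with
  | Lf x => Lf x | Un y s => Un y (mirror s) | Bn l r => Bn (mirror r) (mirror l)
  end.

Fixpoint word t : seq bool :=
  match t with
  | Lf _ => [:: true] | Un _ s => word s | Bn l r => false :: word l ++ word r
  end.

Lemma mirrorK : involutive mirror.
Proof. by elim=> //= [y s ->|l -> r ->]. Qed.

Lemma left_height_mirror t : left_height (mirror t) = right_height t.
Proof. by elim: t => //= l -> r ->; rewrite maxnC. Qed.

Lemma leaves_mirror t : perm_eq (leaves (mirror t)) (leaves t).
Proof. by elim: t => //= l IHl r IHr; rewrite perm_catC perm_cat. Qed.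

Lemma uns_mirror t : perm_eq (uns (mirror t)) (uns t).
Proof.
elim: t => //= [y s|l IHl r IHr]; first by rewrite perm_cons.
by rewrite perm_catC perm_cat.
Qed.

Lemma tree_height_le t : uns t = [::] -> tree_height t <= (left_height t + right_height t).+1.
Proof.
elim: t => //= l IHl r IHr; case ul: (uns l) => //= ur.
by have := IHl ul; have := IHr ur; lia.
Qed.

(** Preorder words form a prefix code; the suffixes make the statement inductive. The labels are
    read separately because [word] forgets them. *)
Lemma word_inj s t v w (a b : seq T) :
  uns s = [::] -> uns t = [::] -> word s ++ v = word t ++ w ->
  leaves s ++ a = leaves t ++ b -> [/\ s = t, v = w & a = b].
Proof.
elim: s t v w a b => [x|//|l IHl r IHr] [y|//|l' r'] v w a b //=.
  by move=> _ _ [->] [-> ->].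
case ul: (uns l) => //= ur; case ul': (uns l') => //= ur' [].
rewrite -!catA => ew el.
have [<- ew' el'] := IHl _ _ _ _ _ ul ul' ew el.
by have [<- -> ->] := IHr _ _ _ _ _ ur ur' ew' el'.
Qed.

Lemma count_word t : count id (word t) = size (leaves t).
Proof. by elim: t => //= l IHl r IHr; rewrite count_cat size_cat IHl IHr. Qed.

Lemma size_word t : (size (word t)).+1 = (size (leaves t)).*2.
Proof. by elim: t => //= l IHl r IHr; rewrite !size_cat; lia. Qed.

Lemma walk_sum_word t : walk_sum (word t) = 1%R.
Proof. by elim: t => //= l IHl r IHr; rewrite walk_sum_cat IHl IHr. Qed.

Lemma good_word t : good (word t).
Proof.
apply/goodP; split; last exact: walk_sum_word.
elim: t => [x [|i] //|y s IHs //|l IHl r IHr [|i] //=].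
rewrite ltnS size_cat => lti.
rewrite take_cat; case: ltnP => [/IHl|le]; first lia.
have := IHr (i - size (word l)); rewrite walk_sum_cat walk_sum_word => /(_ _)/wrap[]; lia.
Qed.

(** Just before a leaf, each left turn on the way to it has contributed -1 and each right turn 0,
    since the left subtree passed by has sum 1. A leaf with the most left turns gives [m]. *)
Lemma left_height_dip t :
  exists2 m, m < size (word t) & walk_sum (take m (word t)) = (- (left_height t)%:Z)%R.
Proof.
elim: t => [x|y s IHs|l [m lm em] r [m' lm' em']] //=; first by exists 0.
rewrite /maxn; case: ltnP => _.
  exists (size (word l) + m').+1; first by rewrite ltnS size_cat ltn_add2l.
  by rewrite /= take_cat ltnNge leq_addr /= addKn walk_sum_cat walk_sum_word em'; lia.
exists m.+1; first by rewrite ltnS size_cat ltn_addr.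
by rewrite /= takel_cat 1?ltnW // em; lia.
Qed.

Lemma genL_uniq x xs : uniq (x :: xs) -> uniq (genL x xs).
Proof.
move=> uxs; apply/count_mem_uniq => t.
have [|/count_memPn->//] := boolP (t \in genL x xs).
by case/mem_genL=> pt ut; rewrite count_genL.
Qed.

Lemma mem_genLE x xs t : uniq (x :: xs) ->
  (t \in genL x xs) = perm_eq (leaves t) (x :: xs) && (uns t == [::]).
Proof.
move=> uxs; apply/idP/andP=> [/mem_genL[-> ->] //|[pt /eqP ut]].
by rewrite -has_pred1 has_count count_genL.
Qed.

(** A tree is encoded by its word and the order of its leaves, whence the factorial; the cycle lemma
    gives the factor on the left. Rotation preserves only half of the dip [2 * a], in either
    direction, hence two binomials at distance [a]. *)
Lemma count_left_height x xs a j : uniq (x :: xs) -> (size xs).+1 = j ->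
  (j.*2).-1 * count (fun t => 2 * a <= left_height t) (genL x xs)
    <= j`! * ('C((j.*2).-1, j.-1 + a) + 'C((j.*2).-1, j + a)).
Proof.
move=> uxs <- {j}; set j := (size xs).+1; set len := (j.*2).-1.
pose dips g := [exists m : 'I_(size g), (walk_sum (take m g) <= - (2 * a)%:Z)%R].
pose G := [seq g <- binary_words len j | good g && dips g].
have c1 : count (fun t => 2 * a <= left_height t) (genL x xs) <= size G * j`!.
  rewrite -size_filter -[j`!](size_permutations uxs) -(size_allpairs (fun w l => (w, l))).
  rewrite -(size_map (fun t => (word t, leaves t))).
  apply: uniq_leq_size.
    rewrite map_inj_in_uniq ?filter_uniq ?genL_uniq // => s t.
    rewrite !mem_filter => /andP[_ /mem_genL[_ us]] /andP[_ /mem_genL[_ ut]] [ew el].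
    by have [] := @word_inj s t [::] [::] [::] [::] us ut _ _; rewrite ?cats0.
  move=> _ /mapP[t + ->]; rewrite mem_filter => /andP[le /mem_genL[pt ut]].
  apply/allpairsP; exists (word t, leaves t); split=> //=; last first.
    by rewrite mem_permutations.
  rewrite mem_filter good_word mem_binary_words count_word (perm_size pt) /= eqxx andbT /=.
  have := size_word t; rewrite (perm_size pt) /= -/j => e; apply/andP; split.
    have [m lm em] := left_height_dip t; apply/existsP; exists (Ordinal lm) => /=.
    by rewrite em; lia.
  by apply/eqP; rewrite /len -e.
have c2 : size G * len <= 'C(len, j.-1 + a) + 'C(len, j + a).
  rewrite -{1}(size_iota 0 len) -(size_allpairs (fun g i => rot i g)).
  apply: leq_trans (_ : count (predU (hit true a) (hit false a)) (binary_words len j) <= _).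
    rewrite -size_filter; apply: uniq_leq_size.
      apply: rot_good_inj; first by rewrite filter_uniq // binary_words_uniq.
      by move=> g; rewrite mem_filter mem_binary_words => /andP[/andP[gg _] /andP[/eqP-> _]].
    move=> _ /allpairsP[[g i] [+ + ->]]; rewrite ![fst _]/= ![snd _]/=.
    rewrite mem_filter mem_binary_words => /andP[/andP[gg dg] /andP[/eqP sg /eqP cg]].
    rewrite mem_iota => /andP[_ lti].
    rewrite mem_filter mem_binary_words size_rot sg eqxx /=.
    have -> : count id (rot i g) = j.
      by rewrite -cg /rot count_cat addnC -count_cat cat_take_drop.
    case/existsP: dg => m dm; rewrite eqxx andbT.
    by apply: (hit_rot gg _ (ltn_ord m) dm); rewrite ?sg.
  apply: leq_trans (_ : count (hit true a) (binary_words len j) + count (hit false a) (binary_words len j) <= _).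
    by rewrite -count_predUI leq_addr.
  have pq : j + j.-1 = len by rewrite /len /j; lia.
  exact: leq_add (count_hit true a pq) (count_hit false a pq).
rewrite mulnC; apply: leq_trans (leq_mul c1 (leqnn _)) _.
by rewrite mulnAC mulnC leq_mul2l c2 orbT.
Qed.

(** If both turn heights were below [2 * a], [tree_height_le] would give a height of at most
    [4 * a - 1]. Mirroring exchanges left and right, whence the factor 2. *)
Lemma count_tree_height_genL x xs a j : uniq (x :: xs) -> (size xs).+1 = j ->
  (j.*2).-1 * count (fun t => 4 * a <= tree_height t) (genL x xs)
    <= 2 * (j`! * ('C((j.*2).-1, j.-1 + a) + 'C((j.*2).-1, j + a))).
Proof.
move=> uxs jE.
have crl : count (fun t => 2 * a <= right_height t) (genL x xs) =
   count (fun t => 2 * a <= left_height t) (genL x xs) :> nat.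
  have pm : perm_eq (map mirror (genL x xs)) (genL x xs).
    apply: uniq_perm; rewrite ?(map_inj_uniq (can_inj mirrorK)) ?genL_uniq //.
    have mE t : (mirror t \in genL x xs) = (t \in genL x xs).
      rewrite !mem_genLE // (permPl (leaves_mirror t)); congr (_ && _).
      apply/eqP/eqP=> e; apply/perm_nilP; rewrite -e ?uns_mirror //.
      by rewrite perm_sym uns_mirror.
    by move=> t; rewrite -{1}(mirrorK t) (mem_map (can_inj mirrorK)) mE.
  rewrite -(permP pm) count_map; apply: eq_count => t /=.
  by rewrite -left_height_mirror mirrorK.
apply: leq_trans (leq_mul (leqnn 2) (count_left_height a uxs jE)); rewrite mulnCA leq_mul2l.
apply/orP; right; rewrite mul2n -addnn -{2}crl -count_predUI.
apply: leq_trans (leq_addr _ _); rewrite -!size_filter.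
apply: uniq_leq_size; first by rewrite filter_uniq ?genL_uniq.
move=> t; rewrite !mem_filter => /andP[le tin]; rewrite tin andbT /=.
by have [_ ut] := mem_genL tin; have := tree_height_le ut; lia.
Qed.

End Words.

(** * Networks and their presentations *)

Section Flips.
Variable T : choiceType.
Implicit Types (s t l r : tree T).

Fixpoint subs t : seq (tree T) :=
  t :: match t with
       | Lf _ => [::] | Un _ s => subs s | Bn l r => subs l ++ subs r
       end.

Fixpoint flips t : seq (tree T) :=
  match t with
  | Lf x => [:: Lf x]
  | Un y s => map (Un y) (flips s)
  | Bn l r => [seq Bn a b | a <- flips l, b <- flips r]
                ++ [seq Bn b a | a <- flips l, b <- flips r]
  end.

Lemma mem_subs t : t \in subs t. Proof. by case: t => *; rewrite inE eqxx. Qed.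

Lemma size_flips t : size (flips t) = 2 ^ (size (leaves t)).-1.
Proof.
elim: t => [//|y s IHs|l IHl r IHr] /=; first by rewrite size_map.
rewrite size_cat !size_allpairs IHl IHr -expnD addnn -muln2 mulnC -expnS size_cat.
by congr (2 ^ _); have := leaves_gt0 l; have := leaves_gt0 r; lia.
Qed.

Lemma mem_flips_Bn l r a b : (Bn a b \in flips (Bn l r)) =
  (a \in flips l) && (b \in flips r) || (a \in flips r) && (b \in flips l).
Proof.
rewrite /= mem_cat; congr (_ || _); apply/allpairsP/andP.
- by case=> -[c d] [/= cl dr [-> ->]].
- by case=> al br; exists (a, b).
- by case=> -[c d] [/= cl dr [-> ->]].
- by case=> ar bl; exists (b, a).
Qed.

Lemma flips_facts s t : s \in flips t ->
  [/\ perm_eq (leaves s) (leaves t), perm_eq (uns s) (uns t),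
      tree_height s = tree_height t & nnodes s = nnodes t].
Proof.
elim: t s => [x|y t IHt|l IHl r IHr] s.
- by rewrite inE => /eqP->.
- by case/mapP=> u /IHt[pl pu h n] ->; rewrite /= perm_cons h n.
case: s => [x|y s|a b]; rewrite ?mem_flips_Bn.
- by rewrite mem_cat => /orP[] /allpairsP[[? ?] []].
- by rewrite mem_cat => /orP[] /allpairsP[[? ?] []].
case/orP=> /andP[] => [/IHl[la ua ha na] /IHr[lb ub hb nb]|/IHr[la ua ha na] /IHl[lb ub hb nb]] /=.
  by split; rewrite ?perm_cat ?ha ?hb ?na ?nb.
split; rewrite ?ha ?hb ?na ?nb.
- by rewrite perm_catC perm_cat.
- by rewrite perm_catC perm_cat.
- by rewrite maxnC.
- by rewrite addnC.
Qed.

Lemma leaves_disjoint s t : perm_eq (leaves s) (leaves t) ->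
  has (mem (leaves s)) (leaves t).
Proof.
move=> p; have := leaves_gt0 t; rewrite -has_predT => /hasP[x xt _].
by apply/hasP; exists x; rewrite //= (perm_mem p).
Qed.

Lemma flips_uniq t : uniq (leaves t) -> uniq (flips t).
Proof.
elim: t => [//|y s IHs us|l IHl r IHr] /=.
  by rewrite map_inj_uniq ?IHs // => ? ? [].
rewrite cat_uniq => /and3P[/IHl ul dis /IHr ur].
rewrite cat_uniq; apply/and3P; split.
- by apply: allpairs_uniq => // -[a b] [c d] _ _ [-> ->].
- apply/hasPn=> _ /allpairsP[[a b] [/= al br ->]]; apply/negP.
  case/allpairsP=> -[c d] [/= cl dr [bc ad]].
  have [pa _ _ _] := flips_facts al; have [pd _ _ _] := flips_facts dr.
  case/negP: dis; rewrite -(eq_has (a1 := mem (leaves d))).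
    by rewrite -(eq_has_r (perm_mem pd)); apply: leaves_disjoint.
  by move=> x /=; rewrite -ad (perm_mem pa).
- by apply: allpairs_uniq => // -[a b] [c d] _ _ [-> ->].
Qed.

Lemma subs_trans s t u : s \in subs t -> t \in subs u -> s \in subs u.
Proof.
move=> st; elim: u => [x|y u IHu|l IHl r IHr] /=; rewrite !inE.
- by move/eqP=> e; rewrite -e in st *; move: st; rewrite e /= inE.
- by case/predU1P=> [e|/IHu->]; [rewrite e in st|rewrite orbT].
- case/predU1P=> [e|]; first by rewrite e in st.
  by rewrite !mem_cat => /orP[/IHl->|/IHr->]; rewrite ?orbT.
Qed.

Lemma subs_Un y s t : Un y s \in subs t -> s \in subs t.
Proof. by apply: subs_trans; rewrite /= inE mem_subs orbT. Qed.

Lemma subs_Bn l r t : Bn l r \in subs t -> (l \in subs t) && (r \in subs t).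
Proof.
by move=> st; rewrite !(subs_trans _ st) //= inE mem_cat mem_subs !orbT.
Qed.

Lemma subs_leaves s t : s \in subs t -> {subset leaves s <= leaves t}.
Proof.
elim: t => [x|y t IHt|l IHl r IHr] /=; rewrite !inE.
- by move/eqP->.
- by case/predU1P=> [->|/IHt].
case/predU1P=> [->//|]; rewrite mem_cat => /orP[/IHl|/IHr] h x /h;
  by rewrite mem_cat => ->; rewrite ?orbT.
Qed.

Lemma subs_nnodes s t : s \in subs t -> (s == t) || (nnodes s < nnodes t).
Proof.
elim: t => [x|y t IHt|l IHl r IHr] /=; rewrite !inE.
- by move/eqP->; rewrite eqxx.
- by case/predU1P=> [->|/IHt/predU1P[->|]]; rewrite ?eqxx ?ltnS //; lia.
case/predU1P=> [->|]; rewrite ?eqxx // mem_cat.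
by case/orP=> [/IHl|/IHr] /predU1P[->|]; lia.
Qed.

(** Subtrees with a common leaf are nested, and of two different nested subtrees the inner one has
    fewer nodes. One leaf and the number of nodes thus identify a subtree. *)
Lemma subs_share s s' t : uniq (leaves t) -> s \in subs t -> s' \in subs t ->
  nnodes s = nnodes s' -> has (mem (leaves s)) (leaves s') -> s = s'.
Proof.
elim: t => [x|y t IHt|l IHl r IHr] ut /=.
- by rewrite !inE => /eqP-> /eqP->.
- rewrite !inE => /predU1P[->|st] /predU1P[->|st'] //= en; last exact: IHt.
    by case/predU1P: (subs_nnodes st') => [e|]; [move: en; rewrite e|]; lia.
  by case/predU1P: (subs_nnodes st) => [e|]; [move: en; rewrite e|]; lia.
move: ut; rewrite /= cat_uniq => /and3P[ul /hasPn dis ur].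
rewrite !inE !mem_cat => /predU1P[->|st] /predU1P[->|st'] //= en.
- by case/orP: st' => /subs_nnodes/predU1P[e|]; try (move: en; rewrite e); lia.
- by case/orP: st => /subs_nnodes/predU1P[e|]; try (move: en; rewrite e); lia.
case/orP: st => st; case/orP: st' => st'; [exact: IHl| | |exact: IHr];
  case/hasP=> x xs' xs; move/subs_leaves: st => /(_ x xs) h;
  move/subs_leaves: st' => /(_ x xs') h'.
- by have := dis x h'; rewrite /= h.
- by have := dis x h; rewrite /= h'.
Qed.

Lemma subs_uniq t : uniq (leaves t) -> uniq (subs t).
Proof.
elim: t => [//|y t IHt ut|l IHl r IHr] /=.
  by rewrite IHt // andbT; apply/negP=> /subs_nnodes /= /predU1P[|]; [move/(congr1 (@nnodes T)) => /=; lia|lia].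
rewrite cat_uniq => /and3P[/IHl ul /hasPn dis /IHr ur].
rewrite cat_uniq ul ur !andbT mem_cat negb_or; apply/andP; split.
  apply/andP; split; apply/negP=> /subs_nnodes /= /predU1P[|];
    try (move/(congr1 (@nnodes T)) => /=); lia.
apply/hasPn=> s sr; apply/negP=> sl.
have := leaves_gt0 s; rewrite -has_predT => /hasP[x xs _].
by have := dis x (subs_leaves sr xs); rewrite /= (subs_leaves sl xs).
Qed.

Lemma subs_Lf x t : (Lf x \in subs t) = (x \in leaves t).
Proof.
have Lf_eq z : (Lf x == Lf z) = (x == z) by apply/eqP/eqP=> [[]|->].
by elim: t => [z|y t IHt|l IHl r IHr] /=; rewrite !inE ?mem_cat ?Lf_eq ?IHt ?IHl ?IHr.
Qed.

Lemma subs_Un_ex y t : y \in uns t -> exists s, Un y s \in subs t.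
Proof.
elim: t => //= [z t IHt|l IHl r IHr].
  rewrite inE => /predU1P[->|/IHt[s st]]; first by exists t; rewrite inE eqxx.
  by exists s; rewrite inE st orbT.
rewrite mem_cat => /orP[/IHl|/IHr] [s st]; exists s;
  by rewrite inE mem_cat st !orbT.
Qed.

End Flips.

Lemma connect_step (V : finType) (e : rel V) u v :
  connect e u v = (u == v) || [exists w, e u w && connect e w v].
Proof.
apply/idP/orP=> [/connectP[[|w p] /= + ->]|[/eqP->//|/existsP[w /andP[uw wv]]]].
- by rewrite eqxx; left.
- case/andP=> uw pw; right; apply/existsP; exists w; rewrite uw.
  by apply/connectP; exists p.
- exact: connect_trans (connect1 uw) wv.
Qed.

Lemma connect_last (V : finType) (e : rel V) u v :
  connect e u v -> u = v \/ exists2 w, connect e u w & e w v.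
Proof.
case/connectP=> p; case/lastP: p => [|p w] + ->; first by left.
rewrite rcons_path last_rcons => /andP[pp ew]; right; exists (last u p) => //.
by apply/connectP; exists p.
Qed.

(** * The drawings of a network *)

Section Presentation.
Variables X V : finType.
Variable N : net X V.

Fixpoint pres (v : V) (t : tree X) : bool :=
  match t with
  | Lf x => v == label N x
  | Un y s => [exists r, exists w, [&& arc N v r, arc N v w, is_reticulation N r,
      arc N r (label N y), ~~ is_reticulation N w & pres w s]]
  | Bn l r => [exists a, exists b, [&& arc N v a, arc N v b, a != b,
      ~~ is_reticulation N a, ~~ is_reticulation N b, pres a l & pres b r]]
  end.

Definition presents (t : tree X) : bool :=
  [exists v, arc N (root N) v && pres v t].

Lemma pres_UnP v y s : reflect
  (exists r w, [/\ arc N v r, arc N v w, is_reticulation N r &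
     [/\ arc N r (label N y), ~~ is_reticulation N w & pres w s]])
  (pres v (Un y s)).
Proof.
apply: (iffP existsP) => [[r /existsP[w /and5P[? ? ? ? /andP[? ?]]]]|].
  by exists r, w.
by case=> r [w [? ? ? [? ? ?]]]; exists r; apply/existsP; exists w; apply/and5P; split=> //; apply/andP.
Qed.

Lemma pres_BnP v l r : reflect
  (exists a b, [/\ arc N v a, arc N v b, a != b &
     [/\ ~~ is_reticulation N a, ~~ is_reticulation N b, pres a l & pres b r]])
  (pres v (Bn l r)).
Proof.
apply: (iffP existsP) => [[a /existsP[b /and5P[? ? ? ? /and3P[? ? ?]]]]|].
  by exists a, b.
by case=> a [b [? ? ? [? ? ? ?]]]; exists a; apply/existsP; exists b; apply/and5P; split=> //; apply/and3P.
Qed.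

Lemma pres_flip v s t : s \in flips t -> pres v t -> pres v s.
Proof.
elim: t s v => [x|y t IHt|l IHl r IHr] s v.
- by rewrite inE => /eqP->.
- case/mapP=> u uin -> /pres_UnP[a [w [va vw ra [ay rw walk_sum]]]].
  by apply/pres_UnP; exists a, w; do !split=> //; apply: IHt walk_sum.
rewrite [flips _]/= mem_cat => /orP[] /allpairsP[[a b] [/= al br ->]];
  case/pres_BnP=> w1 [w2 [v1 v2 ne [r1 r2 p1 p2]]]; apply/pres_BnP.
- exists w1, w2; do !split=> //; [exact: IHl p1|exact: IHr p2].
- exists w2, w1; rewrite eq_sym; do !split=> //; [exact: IHr p2|exact: IHl p1].
Qed.

Lemma presents_flip s t : s \in flips t -> presents t -> presents s.
Proof.
move=> st /existsP[v /andP[rv vt]]; apply/existsP; exists v.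
by rewrite rv (pres_flip st vt).
Qed.

Hypothesis stcN : simplex_tree_child N.

Notation ret := (is_reticulation N).
Notation leaf := (is_leaf N).
Notation arcN := (arc N).

Lemma net_acyclic u v : arcN u v -> ~~ connect arcN v u.
Proof.
have /andP[/forallP acN _] := stcN.
by move=> uv; have /forallP/(_ v)/implyP := acN u; apply.
Qed.

Lemma root_no_in u : ~~ arcN u (root N).
Proof.
have /and3P[_ /andP[/eqP/cards0_eq ri _] _] := stcN.
by apply/negP=> ur; have := in_set0 u; rewrite -ri inE ur.
Qed.

Lemma root_outdeg : outdeg N (root N) = 1.
Proof. by have /and3P[_ /andP[_ /eqP e] _] := stcN. Qed.

Lemma net_reach v : connect arcN (root N) v.
Proof. by have /and3P[_ _ /andP[/forallP/(_ v) e _]] := stcN. Qed.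

Lemma leaf_indeg v : leaf v -> indeg N v = 1.
Proof.
by have /and5P[_ _ _ /forallP/(_ v)/implyP leaf1 _] := stcN; move/leaf1/eqP.
Qed.

Lemma inner_vertex v :
  v != root N -> ~~ leaf v -> is_tree_vertex N v || ret v.
Proof.
have /and5P[_ _ _ _ /andP[/forallP/(_ v)/implyP inner _]] := stcN.
by move=> vr vl; apply: inner; rewrite vr.
Qed.

Lemma tree_child v :
  ~~ leaf v -> exists2 w, arcN v w & is_tree_vertex N w || leaf w.
Proof.
have /and5P[_ _ _ _ /and3P[_ /forallP/(_ v)/implyP tc _]] := stcN.
by move/tc=> /existsP[w /andP[]]; exists w.
Qed.

Lemma ret_child_leaf v w : ret v -> arcN v w -> leaf w.
Proof.
have /and5P[_ _ _ _ /and4P[_ _ /forallP/(_ v)/implyP oc _]] := stcN.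
by move/oc=> /forallP/(_ w)/implyP.
Qed.

Lemma label_inj : injective (label N).
Proof.
by have /and5P[_ _ _ _ /and4P[_ _ _ /andP[/injectiveP]]] := stcN.
Qed.

Lemma leafE v : leaf v = (v \in codom (label N)).
Proof.
by have /and5P[_ _ _ _ /and4P[_ _ _ /andP[_ /forallP/(_ v)/eqP]]] := stcN.
Qed.

Lemma leaf_label x : leaf (label N x). Proof. by rewrite leafE codom_f. Qed.

Lemma leaf_no_out v w : leaf v -> ~~ arcN v w.
Proof.
rewrite /is_leaf => /eqP/cards0_eq e; apply/negP=> vw.
by have := in_set0 w; rewrite -e inE vw.
Qed.

Lemma tree_vertex_nret v : is_tree_vertex N v -> ~~ ret v.
Proof. by rewrite /is_tree_vertex /is_reticulation => /andP[/eqP-> _]. Qed.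

Lemma leaf_nret v : leaf v -> ~~ ret v.
Proof. by rewrite /is_leaf /is_reticulation => /eqP->; rewrite andbF. Qed.

Lemma root_nret : ~~ ret (root N).
Proof.
have /and3P[_ /andP[/eqP ri _] _] := stcN.
by rewrite /is_reticulation ri.
Qed.

Lemma root_nleaf : ~~ leaf (root N).
Proof. by rewrite /is_leaf root_outdeg. Qed.

Lemma parent_uniq u u' v : ~~ ret v -> arcN u v -> arcN u' v -> u = u'.
Proof.
move=> rv uv u'v.
have vr : v != root N by apply: contraTneq uv => ->; apply: root_no_in.
have : indeg N v == 1.
  have [/leaf_indeg->//|vl] := boolP (leaf v).
  have := inner_vertex vr vl; rewrite (negbTE rv) orbF.
  by case/andP=> /eqP-> _.
case/cards1P=> p /setP e; have := e u; have := e u'.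
by rewrite !inE uv u'v => /esym/eqP-> /esym/eqP->.
Qed.

Lemma outdeg_le2 v : outdeg N v <= 2.
Proof.
have [->|vr] := eqVneq v (root N); first by rewrite root_outdeg.
have [/eqP->//|vl] := boolP (leaf v).
by have /orP[/andP[_ /eqP->]|/andP[_ /eqP->]] := inner_vertex vr vl.
Qed.

Lemma two_children v a b c :
  arcN v a -> arcN v b -> a != b -> arcN v c -> c = a \/ c = b.
Proof.
move=> va vb ab vc.
have e : [set a; b] = [set w | arcN v w].
  apply/eqP; rewrite eqEcard cards2 ab outdeg_le2 andbT.
  by apply/subsetP=> w; rewrite !inE => /orP[] /eqP->.
have : c \in [set a; b] by rewrite e inE.
by rewrite !inE => /orP[] /eqP->; [left|right].
Qed.

Lemma ret_indeg v : ret v -> indeg N v = 2.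
Proof. by case/andP=> /eqP. Qed.

Lemma ret_child r : ret r -> exists2 y, arcN r (label N y) &
  forall w, arcN r w -> w = label N y.
Proof.
move=> rr; have /andP[_ /cards1P[w /setP e]] := rr.
have rw : arcN r w by have := e w; rewrite !inE eqxx.
have := ret_child_leaf rr rw; rewrite leafE => /codomP[y wy].
exists y; first by rewrite -wy.
by move=> w' rw'; have := e w'; rewrite !inE rw' wy => /esym/eqP.
Qed.

Lemma root_child : exists2 o, arcN (root N) o & ~~ ret o /\
  forall w, arcN (root N) w -> w = o.
Proof.
have [w rw tw] := tree_child root_nleaf; exists w => //; split.
  by case/orP: tw => [/tree_vertex_nret|/leaf_nret].
have /eqP/cards1P[o /setP e] := root_outdeg.
have := e w; rewrite !inE rw => /esym/eqP-> w' rw'.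
by have := e w'; rewrite !inE rw' => /esym/eqP.
Qed.

(** Induction on the number of descendants. The tree-child condition leaves at most one child to be
    a reticulation, which is why the three constructors of [tree] suffice. *)
Lemma pres_ex v : v != root N -> ~~ ret v -> exists t, pres v t.
Proof.
have [n] := ubnP #|[set w | connect arcN v w]|.
elim: n v => // n IHn v /ltnSE le vr rv.
have IH w : arcN v w -> ~~ ret w -> exists t, pres w t.
  move=> vw rw; apply: IHn => //.
    apply: leq_trans le; apply/proper_card/properP; split.
      apply/subsetP=> u; rewrite !inE; apply: connect_trans; exact: connect1.
    by exists v; rewrite !inE ?connect0 // net_acyclic.
  by apply: contraTneq vw => ->; apply: root_no_in.
have [|vl] := boolP (leaf v).
  by rewrite leafE => /codomP[x ->]; exists (Lf x); rewrite /= eqxx.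
have := inner_vertex vr vl; rewrite (negbTE rv) orbF => /andP[_ o2].
have [a va ta] := tree_child vl.
have ra : ~~ ret a by case/orP: ta => [/tree_vertex_nret|/leaf_nret].
have [b vb ab] : exists2 b, arcN v b & a != b.
  have : ~~ ([set w | arcN v w] \subset [set a]).
    by apply: contraTN o2 => /subset_leq_card; rewrite cards1 /outdeg; lia.
  by case/subsetPn=> b; rewrite !inE => vb ba; exists b; rewrite // eq_sym.
have [t at_] := IH a va ra.
have [rb|rb] := boolP (ret b); last first.
  by have [s bs] := IH b vb rb; exists (Bn t s); apply/pres_BnP; exists a, b.
have [y by_ _] := ret_child rb.
by exists (Un y t); apply/pres_UnP; exists b, a.
Qed.

Lemma presents_ex : exists t, presents t.
Proof.
have [o ro [o_ret _]] := root_child.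
have or : o != root N by apply: contraTneq ro => ->; apply: root_no_in.
have [t ot] := pres_ex or o_ret; exists t; apply/existsP; exists o.
by rewrite ro.
Qed.

Lemma pres_nret v t : pres v t -> ~~ ret v.
Proof.
case: t => [x /= /eqP->|y s /pres_UnP[a [b [va vb ra [_ rb _]]]]|
    l r /pres_BnP[a [b [va vb ab _]]]]; first exact/leaf_nret/leaf_label.
all: apply/negP=> /ret_child[y' _ h].
  by move: rb; rewrite (h _ vb) -(h _ va) ra.
by move: ab; rewrite (h _ vb) -(h _ va) eqxx.
Qed.

(** The children of a vertex drawn as [Un] are told apart by their kind, so only the order at binary
    vertices is free. *)
Lemma pres_flips v s t : pres v t -> pres v s -> s \in flips t.
Proof.
elim: t v s => [x|y t IHt|l IHl r IHr] v.
- case=> [x'|y' s|l' r'] /= /eqP e.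
  + by rewrite e => /eqP/label_inj->; rewrite inE.
  + by case/pres_UnP=> a [b [va _ _ _]]; move: va; rewrite e (negbTE (leaf_no_out _ (leaf_label x))).
  + by case/pres_BnP=> a [b [va _ _ _]]; move: va; rewrite e (negbTE (leaf_no_out _ (leaf_label x))).
- move=> s /pres_UnP[a [b [va vb ra [ay rb bt]]]].
  have ab : a != b by apply: contraNneq rb => <-.
  have two := two_children va vb ab.
  case: s => [x'|y' s|l' r'].
  + by move=> /= /eqP e; move: va; rewrite e (negbTE (leaf_no_out _ (leaf_label x'))).
  + case/pres_UnP=> a' [b' [va' vb' ra' [ay' rb' bt']]].
    have -> : y' = y.
      have e : a' = a by case: (two _ va') => // e; move: ra'; rewrite e (negbTE rb).
      have [z _ h] := ret_child ra; apply: label_inj.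
      by rewrite e in ay'; rewrite (h _ ay); apply: h.
    have e : b' = b by case: (two _ vb') => // e; move: rb'; rewrite e ra.
    by rewrite e in bt'; apply: map_f; apply: IHt bt'.
  + case/pres_BnP=> a' [b' [va' vb' ne [ra' rb' _ _]]].
    have e : a' = b by case: (two _ va') => // e; move: ra'; rewrite e ra.
    have e' : b' = b by case: (two _ vb') => // e'; move: rb'; rewrite e' ra.
    by rewrite e e' eqxx in ne.
- move=> s /pres_BnP[a [b [va vb ab [ra rb al br]]]].
  have two := two_children va vb ab.
  case: s => [x'|y' s|l' r'].
  + by move=> /= /eqP e; move: va; rewrite e (negbTE (leaf_no_out _ (leaf_label x'))).
  + case/pres_UnP=> a' [b' [va' vb' ra' [ay' rb' bt']]].
    by case: (two _ va') => e; move: ra'; rewrite e ?(negbTE ra) ?(negbTE rb).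
  + case/pres_BnP=> a' [b' [va' vb' ne [ra' rb' al' br']]].
    rewrite mem_flips_Bn.
    case: (two _ va') (two _ vb') => ea [] eb; rewrite ?ea ?eb ?eqxx // in ne al' br'.
      by rewrite (IHl _ _ al al') (IHr _ _ br br').
    by rewrite (IHl _ _ al br') (IHr _ _ br al') orbT.
Qed.

Lemma presents_flips s t : presents t -> presents s -> s \in flips t.
Proof.
have [o _ [_ ro]] := root_child.
case/existsP=> v /andP[/ro-> vt] /existsP[w /andP[/ro-> ws]].
exact: pres_flips vt ws.
Qed.

(** Without the arcs into reticulations the network is a forest, by [parent_uniq]; multiplicities in
    a drawing of [v] are reachability in this forest. *)
Definition tarc u w := arcN u w && ~~ ret w.

Lemma tarc_connect u w : connect tarc u w -> connect arcN u w.
Proof. by apply: connect_sub => a b /andP[ab _]; apply: connect1. Qed.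

Lemma tarc_comparable a b u :
  connect tarc a u -> connect tarc b u -> connect tarc a b \/ connect tarc b a.
Proof.
case/connectP=> p pp ->; elim/last_ind: p pp => [|p w IHp] pp; first by right.
move: (pp); rewrite rcons_path last_rcons => /andP[/IHp{}IHp /andP[pw rw]] binary_words.
have [->|[z bz /andP[zw _]]] := connect_last binary_words.
  by left; apply/connectP; exists (rcons p w); rewrite ?last_rcons.
by apply: IHp; rewrite (parent_uniq rw pw zw).
Qed.

Lemma siblings_apart v a b u : tarc v a -> tarc v b -> a != b ->
  connect tarc a u -> ~~ connect tarc b u.
Proof.
move=> va vb ab au; apply/negP=> bu.
have up c d : tarc v c -> tarc v d -> c != d -> ~~ connect tarc c d.
  move=> /andP[vc _] /andP[vd rd] cd; apply/negP=> cd'.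
  have [e|[w cw /andP[wd _]]] := connect_last cd'; first by rewrite e eqxx in cd.
  have := net_acyclic vc; rewrite (parent_uniq rd vd wd).
  by rewrite (tarc_connect cw).
have [h|h] := tarc_comparable au bu; first by rewrite (negbTE (up _ _ va vb ab)) in h.
by rewrite eq_sym in ab; rewrite (negbTE (up _ _ vb va ab)) in h.
Qed.

Lemma tarc_step v u : (connect tarc v u : nat) =
  (u == v) + [exists w, tarc v w && connect tarc w u].
Proof.
rewrite connect_step eq_sym; case: eqP => //= ->.
case: existsP => // -[w /andP[/andP[vw _] /tarc_connect]].
by rewrite (negbTE (net_acyclic vw)).
Qed.

Lemma connect_Un v a b u :
  arcN v a -> arcN v b -> ret a -> ~~ ret b ->
  (connect tarc v u : nat) = (u == v) + connect tarc b u.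
Proof.
move=> va vb ra rb; rewrite tarc_step; congr (_ + _).
have ab : a != b by apply: contraNneq rb => <-.
suff -> : [exists w, tarc v w && connect tarc w u] = connect tarc b u by [].
apply/existsP/idP=> [[w /andP[/andP[vw rw]]]|bu]; last first.
  by exists b; rewrite bu andbT; apply/andP.
by have [e|->//] := two_children va vb ab vw; rewrite e ra in rw.
Qed.

Lemma connect_Bn v a b u :
  arcN v a -> arcN v b -> a != b -> ~~ ret a -> ~~ ret b ->
  (connect tarc v u : nat) = (u == v) + (connect tarc a u + connect tarc b u).
Proof.
move=> va vb ab ra rb; rewrite tarc_step; congr (_ + _).
have ta : tarc v a by apply/andP.
have tb : tarc v b by apply/andP.
have -> : [exists w, tarc v w && connect tarc w u]
          = connect tarc a u || connect tarc b u.
  apply/existsP/orP=> [[w /andP[/andP[vw rw]]]|[au|bu]].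
  - by have [->|->] := two_children va vb ab vw; [left|right].
  - by exists a; rewrite au ta.
  - by exists b; rewrite bu tb.
have [au|//] := boolP (connect tarc a u).
by rewrite (negbTE (siblings_apart ta tb ab au)).
Qed.

Lemma count_leaves v t x : pres v t ->
  count_mem x (leaves t) = connect tarc v (label N x).
Proof.
elim: t v => [z|y t IHt|l IHl r IHr] v /=.
- move/eqP->; rewrite addn0; congr nat_of_bool.
  rewrite connect_step (inj_eq label_inj); case: eqP => //= _.
  apply/esym/negbTE/existsP=> -[w /andP[/andP[]]].
  by rewrite (negbTE (leaf_no_out _ (leaf_label z))).
- case/pres_UnP=> a [b [va vb ra [ay rb /IHt->]]].
  rewrite (connect_Un _ va vb ra rb); case: eqP => // e; move: va.
  by rewrite -e (negbTE (leaf_no_out _ (leaf_label x))).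
- case/pres_BnP=> a [b [va vb ab [ra rb /IHl el /IHr er]]].
  rewrite count_cat el er (connect_Bn _ va vb ab ra rb); case: eqP => // e; move: va.
  by rewrite -e (negbTE (leaf_no_out _ (leaf_label x))).
Qed.

Definition above_ret y u := [exists r, [&& ret r, arcN u r & arcN r (label N y)]].

Lemma count_uns v t y : pres v t ->
  count_mem y (uns t) = \sum_(u | above_ret y u) connect tarc v u.
Proof.
have single v' : \sum_(u | above_ret y u) (u == v') = above_ret y v'.
  rewrite big_mkcond (bigD1 v') //= eqxx big1 ?addn0; first by case: ifP.
  by move=> u /negbTE->; case: ifP.
elim: t v => [z|z t IHt|l IHl r IHr] v /=.
- move/eqP->; rewrite big1 // => u /existsP[a /and3P[ra ua _]].
  rewrite connect_step (_ : [exists w, _] = false) ?orbF.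
    by case: eqP => // e; move: ua; rewrite -e (negbTE (leaf_no_out _ (leaf_label z))).
  apply/negbTE/existsP=> -[w /andP[/andP[]]].
  by rewrite (negbTE (leaf_no_out _ (leaf_label z))).
- case/pres_UnP=> a [b [va vb ra [ay rb /IHt->]]].
  have ab : a != b by apply: contraNneq rb => <-.
  under [RHS]eq_bigr do rewrite (connect_Un _ va vb ra rb).
  rewrite big_split /= single; congr (nat_of_bool _ + _).
  apply/eqP/existsP=> [<-|[c /and3P[rc vc cy]]]; first by exists a; apply/and3P.
  have [e|e] := two_children va vb ab vc; last by rewrite e (negbTE rb) in rc.
  by have [x _ h] := ret_child ra; apply: label_inj; rewrite e in cy; rewrite (h _ ay) (h _ cy).
- case/pres_BnP=> a [b [va vb ab [ra rb /IHl el /IHr er]]].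
  under [RHS]eq_bigr do rewrite (connect_Bn _ va vb ab ra rb).
  rewrite count_cat el er !big_split /= single.
  have [/existsP[c /and3P[rc vc _]]|//] := boolP (above_ret y v).
  by have [e|e] := two_children va vb ab vc; move: rc; rewrite e ?(negbTE ra) ?(negbTE rb).
Qed.

(** The forest below [o] can only be left through a reticulation, after which nothing but its leaf
    follows. *)
Lemma top_reach o u : arcN (root N) o -> u != root N ->
  [|| connect tarc o u, ret u | [exists r, ret r && arcN r u]].
Proof.
have [o' _ [o'r o'u]] := root_child; move=> ro; rewrite (o'u _ ro) {o ro}.
have /connectP[p] := net_reach u; elim/last_ind: p u => [|p w IHp] u /=.
  by move=> _ ->; rewrite eqxx.
rewrite rcons_path last_rcons => /andP[pp pw] -> _.
have [e|ne] := eqVneq (last (root N) p) (root N).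
  by rewrite e in pw; rewrite (o'u _ pw) connect0.
have /or3P[c|rl|/existsP[r /andP[rr rl]]] := IHp _ pp erefl ne.
- have [//|rw] := boolP (ret w); first by rewrite orbT.
  rewrite (connect_trans c) //; apply: connect1; exact/andP.
- by apply/or3P/Or33/existsP; exists (last (root N) p); rewrite rl.
- by have := leaf_no_out w (ret_child_leaf rr rl); rewrite pw.
Qed.

Lemma label_reach o t x : arcN (root N) o -> pres o t ->
  connect tarc o (label N x) = ~~ [exists r, ret r && arcN r (label N x)].
Proof.
move=> ro ot; apply/idP/idP=> [c|/negbTE nr]; last first.
  have xr : label N x != root N.
    by apply: contraNneq root_nleaf => <-; apply: leaf_label.
  have := top_reach ro xr.
  by rewrite nr (negbTE (leaf_nret (leaf_label x))) !orbF.
apply/existsP=> -[r /andP[rr rx]].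
have lx := leaf_nret (leaf_label x).
have [e|[w ow /andP[wx _]]] := connect_last c.
  by rewrite e in ro; have := root_nret; rewrite (parent_uniq lx ro rx) rr.
have e := parent_uniq lx wx rx; rewrite e in ow.
have [e'|[w' _ /andP[_]]] := connect_last ow; last by rewrite rr.
by have := pres_nret ot; rewrite e' rr.
Qed.

(** A parent of a reticulation is not a leaf, nor a reticulation, whose child would be a leaf, nor
    the root, whose child is no reticulation. Hence both parents lie in the forest below [o]. *)
Lemma count_uns_top o t y : arcN (root N) o -> pres o t ->
  count_mem y (uns t) = (y \notin leaves t).*2.
Proof.
move=> ro ot; rewrite (count_uns _ ot).
have -> : (y \notin leaves t) = [exists r, ret r && arcN r (label N y)].
  rewrite -has_pred1 has_count (count_leaves _ ot) (label_reach y ro ot).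
  by case: [exists r, _].
have ly := leaf_nret (leaf_label y).
have [|nr] := boolP [exists r, ret r && arcN r (label N y)]; last first.
  rewrite big1 // => u /existsP[r /and3P[rr _ ry]].
  by case/existsP: nr; exists r; rewrite rr.
case/existsP=> r /andP[rr ry]; rewrite /= -[1.*2](ret_indeg rr) /indeg -sum1dep_card.
apply: eq_big => [u|u].
  apply/existsP/idP=> [[r' /and3P[rr' ur' r'y]]|ur]; last by exists r; apply/and3P.
  by rewrite (parent_uniq ly ry r'y).
case/existsP=> r' /and3P[rr' ur' r'y].
have rt : ~~ ret u.
  by apply/negP=> ru; have := leaf_nret (ret_child_leaf ru ur'); rewrite rr'.
have u_root : u != root N.
  apply: contraTneq ur' => ->; have [o' _ [o'r o'u]] := root_child.
  by apply/negP=> /o'u e; move: o'r; rewrite -e rr'.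
have /or3P[->//|ru|/existsP[q /andP[rq qu]]] := top_reach ro u_root.
  by rewrite ru in rt.
by have := leaf_no_out r' (ret_child_leaf rq qu); rewrite ur'.
Qed.

Lemma presents_valid t : presents t ->
  uniq (leaves t) /\ forall y, count_mem y (uns t) = (y \notin leaves t).*2.
Proof.
case/existsP=> o /andP[ro ot]; split=> [|y]; last exact: count_uns_top ot.
apply/count_mem_uniq => x; rewrite (count_leaves _ ot); congr nat_of_bool.
by rewrite -has_pred1 has_count (count_leaves _ ot); case: connect.
Qed.

(** A path that avoids reticulations is shorter than the bound by one; that one pays for the arc
    from a reticulation to its leaf. *)
Lemma pres_path v t p : pres v t -> path arcN v p -> size p <= tree_height t.
Proof.
elim: t v p => [x|y t IHt|l IHl r IHr] v [|w p] //=.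
- by move/eqP=> -> /andP[]; rewrite (negbTE (leaf_no_out _ (leaf_label x))).
- case/pres_UnP=> a [b [va vb ra [ay rb bt]]] /andP[vw pw].
  have ab : a != b by apply: contraNneq rb => <-.
  have [e|e] := two_children va vb ab vw; last by rewrite ltnS (IHt b) // -e.
  rewrite ltnS e in pw *; apply: leq_trans (tree_height_gt0 t).
  case: p pw => //= c [|d p] //= /and3P[ac cd _].
  by rewrite (negbTE (leaf_no_out d (ret_child_leaf ra ac))) in cd.
- case/pres_BnP=> a [b [va vb ab [ra rb al br]]] /andP[vw pw]; rewrite ltnS.
  have [e|e] := two_children va vb ab vw; rewrite e in pw.
    by rewrite leq_max (IHl a).
  by rewrite leq_max (IHr b) ?orbT.
Qed.

Lemma longer_height_pres t : presents t -> longer_height N <= (tree_height t).+1.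
Proof.
case/existsP=> o /andP[ro ot]; apply/bigmax_leqP=> v _; apply/bigmax_leqP=> k.
case/existsP=> p /andP[pp _]; rewrite -(size_tuple p).
have [o' _ [_ o'u]] := root_child.
case: (val p) pp => //= w q /andP[/o'u-> pw]; rewrite ltnS.
by apply: pres_path ot _; rewrite (o'u _ ro).
Qed.

End Presentation.

Lemma count_mem_sub (T : eqType) (s E : seq T) :
  uniq s -> uniq E -> {subset s <= E} -> count (mem s) E = size s.
Proof.
move=> us uE sE; rewrite -size_filter; apply/perm_size/uniq_perm => //.
  exact: filter_uniq.
by move=> x; rewrite mem_filter /=; apply: andb_idr => /sE.
Qed.

Lemma card_nth (T : eqType) (x0 : T) (E : seq T) (P : pred T) n : size E = n ->
  #|[set i : 'I_n | P (nth x0 E i)]| = count P E.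
Proof.
move=> <-; rewrite count_big -sum1dep_card big_mkcond (big_nth x0) big_mkord.
by apply: eq_bigr => i _; case: (P _).
Qed.

(** * The network drawn by a tree *)

Section Realization.
Variable X : finType.
Implicit Types (t s l r : tree X).

(* Vertices of the network drawn by a tree: [None] is the root, [inl y] the
   reticulation above the leaf [y], and [inr s] the vertex at which the subtree
   [s] hangs, with [inr (Lf y)] for the leaf labelled [y]. *)
Definition vcode := option (X + tree X).
Implicit Types c d : vcode.

Definition vret y : vcode := Some (inl y).
Definition vsub s : vcode := Some (inr s).

Variable t : tree X.
Hypothesis valid_t :
  uniq (leaves t) /\ forall y, count_mem y (uns t) = (y \notin leaves t).*2.

Definition vchildren c : seq vcode :=
  match c with
  | None => [:: vsub t]
  | Some (inl y) => [:: vsub (Lf y)]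
  | Some (inr (Lf _)) => [::]
  | Some (inr (Un y s)) => [:: vret y; vsub s]
  | Some (inr (Bn l r)) => [:: vsub l; vsub r]
  end.

Definition rets := undup (uns t).
(** The leaves below reticulations are not subtrees of [t] and are added separately. The root code
    stays apart: at the head of [vcodes] it makes the root [ord0] and gives the index type the
    successor form that [inord] wants. *)
Definition vrest : seq vcode :=
  map vret rets ++ map vsub (subs t ++ map (@Lf X) rets).
Definition vcodes : seq vcode := None :: vrest.

Let V := 'I_(size vrest).+1.
Definition code (v : V) : vcode := nth None vcodes v.
Definition vertex c : V := inord (index c vcodes).

Definition phi : net X V :=
  Net [set uv | code uv.2 \in vchildren (code uv.1)] ord0
      [ffun x => vertex (vsub (Lf x))].

Lemma vsub_inj : injective vsub. Proof. by move=> s s' []. Qed.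
Lemma vret_inj : injective vret. Proof. by move=> s s' []. Qed.
Lemma Lf_inj : injective (@Lf X). Proof. by move=> x y []. Qed.

Lemma mem_rets y : (y \in rets) = (y \notin leaves t).
Proof.
rewrite mem_undup -has_pred1 has_count valid_t.2.
by case: (y \in leaves t).
Qed.

Lemma mem_vret y : (vret y \in vcodes) = (y \notin leaves t).
Proof.
rewrite inE /= mem_cat (mem_map vret_inj) mem_rets orbC.
by rewrite (_ : _ \in map _ _ = false) //; apply/negbTE/negP => /mapP[].
Qed.

Lemma mem_vsub s :
  (vsub s \in vcodes) = (s \in subs t) || (s \in map (@Lf X) rets).
Proof.
rewrite inE /= mem_cat (mem_map vsub_inj) mem_cat.
by rewrite (_ : _ \in map _ _ = false) //; apply/negbTE/negP => /mapP[].
Qed.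

Lemma mem_vLf x : vsub (Lf x) \in vcodes.
Proof. by rewrite mem_vsub subs_Lf (mem_map Lf_inj) mem_rets orbN. Qed.

Lemma subs_rets_uniq : uniq (subs t ++ map (@Lf X) rets).
Proof.
rewrite cat_uniq subs_uniq ?valid_t.1 // (map_inj_uniq Lf_inj) undup_uniq andbT.
by apply/hasPn=> _ /mapP[y yr ->]; rewrite /= subs_Lf -mem_rets yr.
Qed.

Lemma vcodes_uniq : uniq vcodes.
Proof.
rewrite /= cat_uniq (map_inj_uniq vret_inj) (map_inj_uniq vsub_inj) undup_uniq.
rewrite subs_rets_uniq andbT mem_cat negb_or; apply/and3P; split.
- by apply/andP; split; apply/mapP=> -[].
- by [].
- by apply/hasPn=> _ /mapP[s _ ->]; apply/mapP=> -[].
Qed.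

Lemma code_mem v : code v \in vcodes.
Proof. by rewrite mem_nth //= ltn_ord. Qed.

Lemma vertexK c : c \in vcodes -> code (vertex c) = c.
Proof.
move=> cin; rewrite /code inordK ?nth_index //.
by rewrite -index_mem in cin.
Qed.

Lemma codeK v : vertex (code v) = v.
Proof.
by rewrite /vertex /code index_uniq ?vcodes_uniq ?inord_val //= ltn_ord.
Qed.

Lemma code_root : code ord0 = None. Proof. by []. Qed.

Lemma code_rootE v : (code v == None) = (v == ord0).
Proof. by apply/eqP/eqP=> [e|->//]; rewrite -(codeK v) e -code_root codeK. Qed.

Lemma arc_phi u v : arc phi u v = (code v \in vchildren (code u)).
Proof. by rewrite /arc inE. Qed.

Lemma label_phi x : code (label phi x) = vsub (Lf x).
Proof. by rewrite ffunE vertexK // mem_vLf. Qed.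

Lemma vchildren_mem c d : c \in vcodes -> d \in vchildren c -> d \in vcodes.
Proof.
move=> + din; case: c din => [[y|[x|y s|l r]]|] //= din; rewrite !inE in din.
- by move/eqP: din => -> _; apply: mem_vLf.
- rewrite mem_vsub => /orP[st|/mapP[//]]; case/orP: din => /eqP->; last first.
    by rewrite mem_vsub (subs_Un st).
  rewrite mem_vret -mem_rets mem_undup.
  elim: (t) st => [x|z t' IH|l IHl r IHr] /=; rewrite !inE ?mem_cat.
  + by [].
  + by case/predU1P=> [[-> _]|/IH->]; rewrite ?eqxx ?orbT.
  + by rewrite /= => /orP[/IHl->|/IHr->]; rewrite ?orbT.
- rewrite mem_vsub => /orP[/subs_Bn/andP[lt rt]|/mapP[//]].
  by case/orP: din => /eqP->; rewrite mem_vsub ?lt ?rt.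
- by move/eqP: din => -> _; rewrite mem_vsub mem_subs.
Qed.

Lemma vchildren_uniq c : c \in vcodes -> uniq (vchildren c).
Proof.
case: c => [[y|[x|y s|l r]]|] //; rewrite mem_vsub => /orP[lr|/mapP[//]] /=.
rewrite !inE !andbT (inj_eq vsub_inj); apply/eqP=> e; move: valid_t.1; rewrite -e in lr.
have : ~~ uniq (leaves (Bn l l)).
  rewrite /= cat_uniq; case: (leaves l) (leaves_gt0 l) => //= x a _.
  by rewrite inE eqxx !andbF.
move=> nu ut; case/negP: nu; move: ut; elim: (t) lr => [x|z t' IH|a IHa b IHb] /=; rewrite !inE ?mem_cat //.
case/orP=> [/eqP[<- <-] //|].
by rewrite cat_uniq => /orP[/IHa h /and3P[/h]|/IHb h /and3P[_ _ /h]].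
Qed.

Lemma outdeg_phi v : outdeg phi v = size (vchildren (code v)).
Proof.
rewrite /outdeg -(count_mem_sub (vchildren_uniq (code_mem v)) vcodes_uniq).
  rewrite -(card_nth None _ (erefl : size vcodes = (size vrest).+1)).
  by apply: eq_card => w; rewrite !inE arc_phi.
by move=> d; apply: vchildren_mem; apply: code_mem.
Qed.

(** Each occurrence of a subtree hangs below one parent in [t], except the top one, whose parent is
    the root code; this is the additional term. *)
Lemma sum_count_vsub s0 :
  \sum_(s <- subs t) count_mem (vsub s0) (vchildren (vsub s)) + (s0 == t)
  = count_mem s0 (subs t).
Proof.
pose F s := count_mem (vsub s0) (vchildren (vsub s)).
have FU y s : F (Un y s) = (s == s0) by rewrite /F /= (inj_eq vsub_inj) addn0.
have FB l r : F (Bn l r) = (l == s0) + (r == s0).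
  by rewrite /F /= !(inj_eq vsub_inj) addn0.
rewrite -[\sum_(s <- _) _]/(\sum_(s <- subs t) F s).
elim: t => [x|y t' IH|l IHl r IHr]; rewrite [subs _]/= big_cons.
- by rewrite big_nil [s0 == _]eq_sym /F /= !addn0.
- by rewrite FU /= -IH [s0 == t']eq_sym [s0 == Un y t']eq_sym addnC; congr (_ + _); rewrite addnC.
- rewrite FB big_cat /= count_cat -IHl -IHr [s0 == l]eq_sym [s0 == r]eq_sym.
  rewrite [s0 == Bn l r]eq_sym addnC; congr (_ + _).
  by rewrite addnACA; congr (_ + _); rewrite addnC.
Qed.

Lemma sum_count_vret y :
  \sum_(s <- subs t) count_mem (vret y) (vchildren (vsub s)) = count_mem y (uns t).
Proof.
pose F s := count_mem (vret y) (vchildren (vsub s)).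
have FU z s : F (Un z s) = (z == y) by rewrite /F /= (inj_eq vret_inj) !addn0.
rewrite -[\sum_(s <- _) _]/(\sum_(s <- subs t) F s).
elim: t => [x|z t' IH|l IHl r IHr]; rewrite [subs _]/= big_cons.
- by rewrite big_nil.
- by rewrite FU IH.
- by rewrite big_cat /= count_cat IHl IHr.
Qed.

Lemma indeg_phi v : indeg phi v =
  match code v with None => 0 | Some (inl _) => 2 | Some (inr _) => 1 end.
Proof.
have -> : indeg phi v = \sum_(c <- vcodes) count_mem (code v) (vchildren c).
  transitivity (count (fun c => code v \in vchildren c) vcodes).
    rewrite -(card_nth None _ (erefl : size vcodes = (size vrest).+1)).
    by apply: eq_card => u; rewrite !inE arc_phi.
  rewrite count_big !big_seq; apply: eq_bigr => c cin.
  by rewrite count_uniq_mem ?vchildren_uniq.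
rewrite big_cons big_cat !big_map big_cat big_map.
have := code_mem v; case: (code v) => [[y|s]|] cin.
- rewrite -/(vret y) sum_count_vret valid_t.2 -mem_vret cin.
  by rewrite !big1.
- rewrite -/(vsub s) -/(vsub s) [X in X + _](_ : _ = (s == t) :> nat); last first.
    by rewrite /= addn0 (inj_eq vsub_inj) eq_sym.
  have -> : \sum_(y <- rets) count_mem (vsub s) (vchildren (vret y)) =
      count_mem s (map (@Lf X) rets).
    rewrite count_map count_big; apply: eq_bigr => y _ /=.
    by rewrite (inj_eq vsub_inj) addn0.
  have -> : \sum_(y <- rets) count_mem (vsub s) (vchildren (vsub (Lf y))) = 0.
    by rewrite big1.
  have := sum_count_vsub s.
  have : count_mem s (subs t ++ map (@Lf X) rets) = 1.
    by rewrite count_uniq_mem ?subs_rets_uniq // mem_cat -mem_vsub cin.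
  rewrite count_cat => e1 e2; move: e1; rewrite -e2 => <-.
  by rewrite /= addn0 [RHS]addnC [_ + (s == t)]addnC addnCA.
- rewrite big1_seq // big1_seq ?big1_seq //; by case.
Qed.

Lemma phi_ret v y : code v = vret y -> is_reticulation phi v.
Proof. by move=> e; rewrite /is_reticulation indeg_phi outdeg_phi e. Qed.

Lemma phi_nret v s : code v = vsub s -> ~~ is_reticulation phi v.
Proof. by move=> e; rewrite /is_reticulation indeg_phi e. Qed.

Lemma phi_leaf v : is_leaf phi v = (v \in codom (label phi)).
Proof.
rewrite /is_leaf outdeg_phi; apply/eqP/codomP=> [|[x ->]]; last first.
  by rewrite label_phi.
case e: (code v) => [[y|[x|y s|l r]]|] //= _; exists x.
by rewrite ffunE -(codeK v) e.
Qed.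

(** A rank that decreases along arcs, for acyclicity. It is 0 instead of 1 at leaves to leave room
    for the rank of reticulations. *)
Definition vrank c : nat :=
  match c with
  | None => (nnodes t).+1
  | Some (inl _) => 1
  | Some (inr (Lf _)) => 0
  | Some (inr s) => nnodes s
  end.

Lemma vrank_sub s : vrank (vsub s) <= nnodes s. Proof. by case: s. Qed.

Lemma vrank_lt c d : d \in vchildren c -> vrank d < vrank c.
Proof.
have n0 s : 0 < nnodes s by case: s.
case: c => [[y|[x|y s|l r]]|] //=; rewrite !inE.
- by move/eqP->.
- by case/orP=> /eqP->; rewrite ?ltnS ?n0 // vrank_sub.
- by case/orP=> /eqP->; rewrite ltnS (leq_trans (vrank_sub _)) ?leq_addr ?leq_addl.
- by move/eqP->; rewrite ltnS vrank_sub.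
Qed.

Lemma connect_vrank u v : connect (arc phi) u v -> vrank (code v) <= vrank (code u).
Proof.
case/connectP=> p + ->; elim: p u => //= w p IHp u /andP[uw /IHp le].
by rewrite arc_phi in uw; apply: leq_trans le (ltnW (vrank_lt uw)).
Qed.

Lemma arc_vertex c d : c \in vcodes -> d \in vchildren c ->
  arc phi (vertex c) (vertex d).
Proof.
by move=> cin din; rewrite arc_phi !vertexK // (vchildren_mem cin).
Qed.

Lemma vsub_in s : s \in subs t -> vsub s \in vcodes.
Proof. by rewrite mem_vsub => ->. Qed.

Lemma reach_sub s : s \in subs t -> connect (arc phi) ord0 (vertex (vsub s)).
Proof.
have top : connect (arc phi) ord0 (vertex (vsub t)).
  apply: connect1; rewrite -[ord0]codeK; apply: arc_vertex; last exact: mem_head.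
  exact: mem_head.
suff H u : u \in subs t -> connect (arc phi) ord0 (vertex (vsub u)) ->
    s \in subs u -> connect (arc phi) ord0 (vertex (vsub s)).
  by move=> st; apply: (H t) => //; apply: mem_subs.
elim: u => [x|y u IHu|l IHl r IHr] ut cu; rewrite [subs _]/= inE.
- by move/eqP->.
- case/predU1P=> [->//|]; apply: IHu; first exact: subs_Un ut.
  apply: connect_trans cu (connect1 _); apply: arc_vertex; first exact: vsub_in.
  by rewrite !inE eqxx orbT.
- have /andP[lt rt] := subs_Bn ut.
  have cl : vsub l \in vchildren (vsub (Bn l r)) by apply: mem_head.
  have cr : vsub r \in vchildren (vsub (Bn l r)) by rewrite in_cons mem_head orbT.
  case/predU1P=> [->|]; first exact: cu.
  rewrite mem_cat => /orP[]; [apply: IHl lt _|apply: IHr rt _].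
    exact: connect_trans cu (connect1 (arc_vertex (vsub_in ut) cl)).
  exact: connect_trans cu (connect1 (arc_vertex (vsub_in ut) cr)).
Qed.

Lemma reach_ret y : y \in rets -> connect (arc phi) ord0 (vertex (vret y)).
Proof.
rewrite mem_undup => /subs_Un_ex[s st].
apply: connect_trans (reach_sub st) (connect1 _).
by apply: arc_vertex; [apply: vsub_in|rewrite mem_head].
Qed.

Lemma phi_reach v : connect (arc phi) ord0 v.
Proof.
rewrite -[v]codeK; have := code_mem v; case e: (code v) => [[y|s]|].
- by rewrite -/(vret y) mem_vret -mem_rets; apply: reach_ret.
- rewrite -/(vsub s) mem_vsub => /orP[|/mapP[y yr ->]]; first exact: reach_sub.
  apply: connect_trans (reach_ret yr) (connect1 _).
  by apply: arc_vertex; rewrite ?mem_vret -?mem_rets // mem_head.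
- by rewrite -code_root codeK connect0.
Qed.

Lemma phi_treelike v s : code v = vsub s -> is_tree_vertex phi v || is_leaf phi v.
Proof.
move=> e; rewrite /is_tree_vertex /is_leaf indeg_phi outdeg_phi e.
by case: s {e}.
Qed.

Lemma phi_stc : simplex_tree_child phi.
Proof.
apply/and5P; split; last (apply/and4P; split).
- apply/forallP=> u; apply/forallP=> v; apply/implyP=> uv.
  apply/negP=> /connect_vrank; rewrite leqNgt; case/negP.
  by apply: vrank_lt; rewrite -arc_phi.
- by rewrite indeg_phi outdeg_phi code_root.
- by apply/forallP=> v; apply: phi_reach.
- apply/forallP=> v; apply/implyP; rewrite phi_leaf => /codomP[x ->].
  by rewrite indeg_phi label_phi.
- apply/forallP=> v; apply/implyP=> /andP[].
  rewrite -code_rootE /is_tree_vertex /is_reticulation /is_leaf indeg_phi outdeg_phi.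
  by case: (code v) => [[y|[x|y s|l r]]|].
- apply/forallP=> v; apply/implyP=> nl.
  suff [s sv] : exists s, vsub s \in vchildren (code v).
    apply/existsP; exists (vertex (vsub s)).
    have sin := vchildren_mem (code_mem v) sv.
    by rewrite arc_phi vertexK // sv (phi_treelike (vertexK sin)).
  move: nl; rewrite /is_leaf outdeg_phi.
  case: (code v) => [[y|[x|y s|l r]]|] //= _.
  + by exists (Lf y); rewrite mem_head.
  + by exists s; rewrite !inE eqxx orbT.
  + by exists l; rewrite mem_head.
  + by exists t; rewrite mem_head.
- apply/forallP=> v; apply/implyP; rewrite /is_reticulation indeg_phi outdeg_phi.
  case e: (code v) => [[y|s]|] //= _; apply/forallP=> w; apply/implyP.
  rewrite arc_phi e inE phi_leaf => /eqP ew.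
  by apply/codomP; exists y; rewrite -[w]codeK ew ffunE.
- apply/andP; split; last by apply/forallP=> v; rewrite phi_leaf.
  apply/injectiveP=> x y /(congr1 code); rewrite !label_phi.
  by move/vsub_inj/Lf_inj.
Qed.

Lemma phi_pres s : s \in subs t -> pres phi (vertex (vsub s)) s.
Proof.
elim: s => [x|y s IHs|l IHl r IHr] st.
- by rewrite /= ffunE.
- have sin := vsub_in st; have ss := subs_Un st.
  have rin := vchildren_mem sin (mem_head _ _).
  apply/pres_UnP; exists (vertex (vret y)), (vertex (vsub s)); split.
  + by apply: arc_vertex; rewrite ?mem_head.
  + by apply: arc_vertex; rewrite // !inE eqxx orbT.
  + by apply: phi_ret; apply: vertexK.
  + split; [|by apply: phi_nret; apply/vertexK/vsub_in|exact: IHs].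
    by rewrite arc_phi label_phi vertexK // mem_head.
- have sin := vsub_in st; have /andP[ls rs] := subs_Bn st.
  apply/pres_BnP; exists (vertex (vsub l)), (vertex (vsub r)); split.
  + by apply: arc_vertex; rewrite ?mem_head.
  + by apply: arc_vertex; rewrite // !inE eqxx orbT.
  + have := vchildren_uniq sin; rewrite /= inE andbT; apply: contraNneq.
    by move/(congr1 code); rewrite (vertexK (vsub_in ls)) (vertexK (vsub_in rs)) => ->.
  + by split; [apply: phi_nret; apply/vertexK/vsub_in
              |apply: phi_nret; apply/vertexK/vsub_in|exact: IHl|exact: IHr].
Qed.

Lemma phi_presents : presents phi t.
Proof.
apply/existsP; exists (vertex (vsub t)); rewrite phi_pres ?mem_subs // andbT.
by rewrite arc_phi vertexK ?vsub_in ?mem_subs // code_root mem_head.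
Qed.

End Realization.

(** * A network is determined by any of its drawings *)

Section Reconstruction.
Variables X V : finType.
Variable N : net X V.
Hypothesis stcN : simplex_tree_child N.
Variable t : tree X.
Hypothesis pres_t : presents N t.
Implicit Types (s l r : tree X).

Notation ret := (is_reticulation N).
Notation arcN := (arc N).

Let valid_t := presents_valid stcN pres_t.

Lemma pres_inner_out v u s : pres N v s -> arcN v u ->
  exists a b, [/\ arcN v a, arcN v b & a != b].
Proof.
case: s => [x /= /eqP-> vu|y s /pres_UnP[a [b [va vb ra [_ rb _]]]]|
  l r /pres_BnP[a [b [va vb ab _]]]] *.
- by have := leaf_no_out u (leaf_label stcN x); rewrite vu.
- by exists a, b; split=> //; apply: contraNneq rb => <-.
- by exists a, b.
Qed.

Lemma pres_nroot v s : pres N v s -> v != root N.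
Proof.
move=> vs; apply/negP=> /eqP e; rewrite {}e in vs.
have [o ro [_ ou]] := root_child stcN.
have [a [b [/ou-> /ou->]]] := pres_inner_out vs ro.
by rewrite eqxx.
Qed.

Lemma pres_inj v w s : pres N v s -> pres N w s -> v = w.
Proof.
elim: s v w => [x|y s IHs|l IHl r IHr] v w.
- by move=> /eqP-> /eqP->.
- case/pres_UnP=> a [b [va vb ra [_ rb bs]]] /pres_UnP[a' [b' [_ wb' _ [_ _ bs']]]].
  by apply: (parent_uniq stcN rb vb); rewrite (IHs _ _ bs bs').
- case/pres_BnP=> a [b [va vb _ [ra _ al _]]] /pres_BnP[a' [b' [wa' _ _ [_ _ al' _]]]].
  by apply: (parent_uniq stcN ra va); rewrite (IHl _ _ al al').
Qed.

Lemma pres_tarc u w s : pres N u s -> tarc N u w ->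
  exists2 s', s' \in subs s & pres N w s'.
Proof.
case: s => [x|y s|l r] + /andP[uw rw].
- by move/eqP=> e; have := leaf_no_out w (leaf_label stcN x); rewrite -e uw.
- case/pres_UnP=> a [b [va vb ra [_ rb bs]]]; exists s; first by rewrite inE mem_subs orbT.
  have ab : a != b by apply: contraNneq rb => <-.
  by have [e|->//] := two_children stcN va vb ab uw; rewrite e ra in rw.
- case/pres_BnP=> a [b [va vb ab [ra rb al br]]].
  have [->|->] := two_children stcN va vb ab uw.
    by exists l; rewrite // inE mem_cat mem_subs orbT.
  by exists r; rewrite // inE mem_cat mem_subs !orbT.
Qed.

Lemma pres_connect u w s : pres N u s -> connect (tarc N) u w ->
  exists2 s', s' \in subs s & pres N w s'.
Proof.
move=> us /connectP[p + ->]; elim: p u s us => [|v p IHp] u s us /=.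
  by exists s; rewrite ?mem_subs.
case/andP=> /(pres_tarc us)[s' s's vs'] /(IHp _ _ vs')[s'' s''s' ps''].
by exists s'' => //; apply: subs_trans s's.
Qed.

Lemma pres_vertex v s s' : pres N v s -> s' \in subs s -> exists w, pres N w s'.
Proof.
elim: s v => [x|y s IHs|l IHl r IHr] v vs; rewrite [subs _]/= inE.
- by move/eqP->; exists v.
- case/predU1P=> [->|]; first by exists v.
  by case/pres_UnP: vs => a [b [_ _ _ [_ _ bs]]]; apply: IHs bs.
- case/predU1P=> [->|]; first by exists v.
  case/pres_BnP: vs => a [b [_ _ _ [_ _ al br]]].
  by rewrite mem_cat => /orP[]; [apply: IHl al|apply: IHr br].
Qed.

(** The graph of the isomorphism onto [phi t], as a relation. Flips of a subtree also draw [v];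
    membership in [vcodes t] selects one of them. *)
Definition coded v (c : vcode X) : bool :=
  (c \in vcodes t) &&
  match c with
  | None => v == root N
  | Some (inl y) => ret v && arcN v (label N y)
  | Some (inr s) => pres N v s
  end.

Let o : V := xchoose (existsP pres_t).
Let ro : arcN (root N) o. Proof. by have /andP[] := xchooseP (existsP pres_t). Qed.
Let ot : pres N o t. Proof. by have /andP[] := xchooseP (existsP pres_t). Qed.

Lemma leaves_ret y :
  (y \notin leaves t) = [exists r, ret r && arcN r (label N y)].
Proof.
rewrite -has_pred1 has_count (count_leaves stcN _ ot) (label_reach stcN y ro ot).
by case: [exists r, _].
Qed.

Lemma coded_ex v : exists c, coded v c.
Proof.
have [->|vr] := eqVneq v (root N); first by exists None; rewrite /coded mem_head eqxx.
have /or3P[c|rv|/existsP[r /andP[rr rv]]] := top_reach stcN ro vr.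
- have [s st vs] := pres_connect ot c.
  by exists (vsub s); rewrite /coded (vsub_in st).
- have [y vy _] := ret_child stcN rv; exists (vret y).
  rewrite /coded (mem_vret valid_t) leaves_ret /= rv vy !andbT.
  by apply/existsP; exists v; rewrite rv.
- have := ret_child_leaf stcN rr rv; rewrite (leafE stcN) => /codomP[y ->].
  by exists (vsub (Lf y)); rewrite /coded (mem_vLf valid_t) /= eqxx.
Qed.

Lemma coded_vertex c : c \in vcodes t -> exists v, coded v c.
Proof.
rewrite /coded; case: c => [[y|s]|] cin; rewrite cin /=; last by exists (root N).
  move: (cin); rewrite -/(vret y) (mem_vret valid_t) leaves_ret => /existsP[r h].
  by exists r.
move: (cin); rewrite -/(vsub s) mem_vsub => /orP[|/mapP[y _ ->]].
  exact: pres_vertex ot.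
by exists (label N y); rewrite /= eqxx.
Qed.

Lemma coded_injl v w c : coded v c -> coded w c -> v = w.
Proof.
rewrite /coded; case: c => [[y|s]|] /andP[_ +] /andP[_ +]; last by move=> /eqP-> /eqP->.
  case/andP=> _ vy /andP[_ wy].
  exact: (parent_uniq stcN (leaf_nret (leaf_label stcN y)) vy wy).
exact: pres_inj.
Qed.

Lemma pres_label y s : pres N (label N y) s -> s = Lf y.
Proof.
move=> ys; have ly : pres N (label N y) (Lf y) by rewrite /= eqxx.
by have := pres_flips stcN ly ys; rewrite inE => /eqP.
Qed.

Lemma coded_injr v c d : coded v c -> coded v d -> c = d.
Proof.
rewrite /coded; case: c d => [[y|s]|] [[y'|s']|] /andP[cin +] /andP[din +] //.
- case/andP=> rv vy /andP[_ vy']; have [z _ h] := ret_child stcN rv.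
  by congr (Some (inl _)); apply: (label_inj stcN); rewrite (h _ vy) (h _ vy').
- by case/andP=> rv _ /(pres_nret stcN); rewrite rv.
- by case/andP=> rv _ /eqP e; have := root_nret stcN; rewrite -e rv.
- by move=> /(pres_nret stcN)/negbTE->.
(* Both subtrees draw [v], so they are flips of each other and agree in leaves and number of nodes;
   within [t] this makes them equal. *)
- move=> vs vs'; congr (Some (inr _)).
  move: (cin) (din); rewrite -/(vsub s) -/(vsub s') !mem_vsub.
  case/orP=> [st|/mapP[y _ e]]; last first.
    by move: vs; rewrite e => /eqP ev; rewrite ev in vs'; rewrite (pres_label vs').
  case/orP=> [st'|/mapP[y _ e]]; last first.
    by move: vs'; rewrite e => /eqP ev; rewrite ev in vs; rewrite (pres_label vs).
  have [pl _ _ en] := flips_facts (pres_flips stcN vs vs').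
  apply: (subs_share valid_t.1 st st') => //; apply: leaves_disjoint.
  by rewrite perm_sym.
- by move=> /pres_nroot/negbTE->.
- by move=> /eqP-> /andP[rv _]; have := root_nret stcN; rewrite rv.
- by move=> /eqP-> /pres_nroot; rewrite eqxx.
Qed.

Lemma coded_arc u v c d : coded u c -> coded v d ->
  arcN u v = (d \in vchildren t c).
Proof.
move=> uc vd; have cin : c \in vcodes t by case/andP: uc.
have sub_in := vchildren_mem valid_t cin.
have link w e : arcN u w -> e \in vchildren t c ->
    (e \in vcodes t -> coded w e) -> w = v -> d \in vchildren t c.
  by move=> uw ein /(_ (sub_in _ ein)) we wv; rewrite wv in we; rewrite (coded_injr vd we).
apply/idP/idP=> [uv|]; last first.
  case/andP: uc vd => _; move: (cin) (sub_in d).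
  case: (c) => [[y|[x|y s|l r]]|] //= _ _; rewrite !inE.
  - by case/andP=> _ uy + /eqP e; rewrite e => /andP[_ /eqP->].
  - case/pres_UnP=> a [b [ua ub ra [ay rb bs]]] + /orP[] /eqP e; rewrite e.
      case/andP=> _ /andP[_ vy].
      by rewrite (parent_uniq stcN (leaf_nret (leaf_label stcN y)) vy ay).
    by case/andP=> _ vs; rewrite (pres_inj vs bs).
  - case/pres_BnP=> a [b [ua ub ab [ra rb al br]]] + /orP[] /eqP e; rewrite e.
      by case/andP=> _ vl; rewrite (pres_inj vl al).
    by case/andP=> _ vr; rewrite (pres_inj vr br).
  - by move=> /eqP-> + /eqP e; rewrite e => /andP[_ vt]; rewrite (pres_inj vt ot).
case/andP: uc => _; move: link {sub_in}.
case: (c) cin => [[y|[x|y s|l r]]|] cin link /=.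
- case/andP=> ru uy; have [z _ h] := ret_child stcN ru.
  apply: (link _ _ uy (mem_head _ _)); last by rewrite (h _ uy) (h _ uv).
  by move=> ein; rewrite /coded ein /= eqxx.
- by move/eqP=> e; have := leaf_no_out v (leaf_label stcN x); rewrite -e uv.
- case/pres_UnP=> a [b [ua ub ra [ay rb bs]]].
  have ab : a != b by apply: contraNneq rb => <-.
  have [e|e] := two_children stcN ua ub ab uv.
    apply: (link _ _ ua (mem_head _ _)) => // ein.
    by rewrite /coded ein ra.
  apply: (link _ (vsub s) ub) => // [|ein]; first by rewrite !inE eqxx orbT.
  by rewrite /coded ein.
- case/pres_BnP=> a [b [ua ub ab [ra rb al br]]].
  have [e|e] := two_children stcN ua ub ab uv.
    apply: (link _ _ ua (mem_head _ _)) => // ein.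
    by rewrite /coded ein.
  apply: (link _ (vsub r) ub) => // [|ein]; first by rewrite !inE eqxx orbT.
  by rewrite /coded ein.
- move=> /eqP e; rewrite e in uv link; have [o' _ [_ o'u]] := root_child stcN.
  apply: (link _ _ ro (mem_head _ _)) => [ein|]; first by rewrite /coded ein /=.
  by rewrite (o'u _ uv) (o'u _ ro).
Qed.

Lemma presents_iso : net_iso N (phi t).
Proof.
pose c v := xchoose (coded_ex v).
have cP v : coded v (c v) := xchooseP (coded_ex v).
have cin v : c v \in vcodes t by case/andP: (cP v).
have cE v d : coded v d -> c v = d := coded_injr (cP v).
apply/net_isoP; exists (fun v => vertex t (c v)); split.
- apply: inj_card_bij => [u v e|].
    apply: (@coded_injl _ _ (c u)) => //.
    by rewrite -(vertexK (cin u)) e (vertexK (cin v)).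
  (* Surjectivity by cardinality: [g] is an injection in the other direction. *)
  pose g (i : 'I_(size (vrest t)).+1) := xchoose (coded_vertex (code_mem i)).
  apply: (@leq_card _ _ g) => i j e; rewrite -(codeK valid_t i) -(codeK valid_t j).
  congr (vertex t _); have := xchooseP (coded_vertex (code_mem i)).
  have := xchooseP (coded_vertex (code_mem j)); rewrite -/(g i) -/(g j) e => h h'.
  exact: coded_injr h' h.
- by move=> u v; rewrite arc_phi !vertexK // -(coded_arc (cP u) (cP v)).
- have -> : c (root N) = None by apply: cE; rewrite /coded mem_head eqxx.
  by rewrite -[RHS](codeK valid_t) code_root.
- move=> x; rewrite (_ : c _ = vsub (Lf x)) ?ffunE //; apply: cE.
  by rewrite /coded (mem_vLf valid_t) /= eqxx.
Qed.

End Reconstruction.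

(** * Counting networks *)

Local Open Scope quotient_scope.

Section IsoInvariance.
Variables (X V W : finType) (N : net X V) (M : net X W).

Lemma presents_iso_inv t : net_iso N M -> presents N t -> presents M t.
Proof.
case/net_isoP=> f [[g fK gK] af rf lf].
have out v : outdeg M (f v) = outdeg N v.
  rewrite /outdeg -(card_imset _ (can_inj fK)); apply: eq_card => w.
  rewrite inE; apply/idP/imsetP=> [vw|[u]]; last by rewrite inE => vu ->; rewrite af.
  by exists (g w); rewrite ?gK // inE -af gK.
have inn v : indeg M (f v) = indeg N v.
  rewrite /indeg -(card_imset _ (can_inj fK)); apply: eq_card => w.
  rewrite inE; apply/idP/imsetP=> [vw|[u]]; last by rewrite inE => vu ->; rewrite af.
  by exists (g w); rewrite ?gK // inE -af gK.
have retE v : is_reticulation M (f v) = is_reticulation N v.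
  by rewrite /is_reticulation out inn.
have pf v s : pres N v s -> pres M (f v) s.
  elim: s v => [x|y s IHs|l IHl r IHr] v.
  - by move=> /eqP->; rewrite /= lf.
  - case/pres_UnP=> a [b [va vb ra [ay rb /IHs bs]]]; apply/pres_UnP.
    by exists (f a), (f b); rewrite -lf !af !retE.
  - case/pres_BnP=> a [b [va vb ab [ra rb /IHl al /IHr br]]]; apply/pres_BnP.
    by exists (f a), (f b); rewrite !af !retE (can_eq fK).
case/existsP=> o /andP[ro /pf ot]; apply/existsP; exists (f o).
by rewrite -rf af ro.
Qed.

End IsoInvariance.

Definition valid_tree (X : finType) (t : tree X) : Prop :=
  uniq (leaves t) /\ forall y, count_mem y (uns t) = (y \notin leaves t).*2.

Lemma valid_flip (X : finType) (s t : tree X) :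
  s \in flips t -> valid_tree t -> valid_tree s.
Proof.
case/flips_facts=> pl pu _ _ [ul ut]; split; first by rewrite (perm_uniq pl).
by move=> y; rewrite (permP pu) ut (perm_mem pl).
Qed.

Section Classes.
Variable n : nat.
Implicit Types (N M : STCN n) (t s : tree 'I_n) (J : {set 'I_n}) (A : {set STCN n}).

Definition graph N := concrete_graph (repr N).

Lemma graph_stc N : simplex_tree_child (graph N).
Proof. exact: valP (tagged (repr N)). Qed.

Definition drawing N : tree 'I_n := xchoose (presents_ex (graph_stc N)).

Lemma drawingP N : presents (graph N) (drawing N).
Proof. exact: xchooseP. Qed.

Lemma drawing_valid N : valid_tree (drawing N).
Proof. exact: presents_valid (graph_stc N) _ (drawingP N). Qed.

Lemma presents_drawing N t : presents (graph N) t = (t \in flips (drawing N)).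
Proof.
apply/idP/idP=> [|tin]; first exact: presents_flips (graph_stc N) _ _ (drawingP N).
exact: presents_flip tin (drawingP N).
Qed.

Lemma presents_eq N M t : presents (graph N) t -> presents (graph M) t -> N = M.
Proof.
move=> Nt Mt; rewrite -(reprK N) -(reprK M); apply/eqmodP.
apply: net_iso_comp (presents_iso (graph_stc N) Nt) _.
exact/net_iso_imp/(presents_iso (graph_stc M) Mt).
Qed.

(** [card_net_le] lets [phi t] fit into [concrete_net n], and presentations pass to the chosen
    representative of its class. *)
Lemma valid_presents t : valid_tree t -> exists N, presents (graph N) t.
Proof.
move=> vt; have stc := phi_stc vt; have := card_net_le stc.
rewrite !card_ord -ltnS => le.
pose c : concrete_net n := @Tagged _ (Ordinal le)
  (fun m : 'I_(4 * n).+1 => {N : net 'I_n 'I_m | simplex_tree_child N})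
  (exist _ (phi t) stc).
exists (\pi_(STCN n) c); apply: (@presents_iso_inv _ _ _ (phi t)).
  have : concrete_iso (repr (\pi_(STCN n) c)) c by apply/eqmodP; rewrite reprK.
  exact: net_iso_imp.
exact: phi_presents.
Qed.

Definition tree_taxa N : {set 'I_n} := [set x | x \in leaves (drawing N)].

Definition gen J : seq (tree 'I_n) :=
  if enum J is x :: xs then genU (enum (~: J)) (genL x xs) else [::].

Lemma gen_valid J t : t \in gen J -> valid_tree t /\ leaves t =i J.
Proof.
rewrite /gen; case e: (enum J) => [//|x xs] /mem_genU[s /mem_genL[ls us] [lt ut]].
have uJ := enum_uniq (mem J); rewrite e in uJ.
have lE : leaves t =i J by move=> y; rewrite lt (perm_mem ls) -e mem_enum.
split=> //; split; first by rewrite lt (perm_uniq ls).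
move=> y; rewrite (permP ut) us cats0 count_cat addnn lE.
by rewrite count_uniq_mem ?enum_uniq // mem_enum inE.
Qed.

Lemma count_gen J t : valid_tree t -> leaves t =i J ->
  count_mem t (gen J) = 2 ^ #|~: J|.
Proof.
move=> [ul ut] lJ; rewrite /gen.
have pl : perm_eq (leaves t) (enum J).
  by apply: uniq_perm; rewrite ?enum_uniq // => y; rewrite lJ mem_enum.
case e: (enum J) pl => [|x xs] pl.
  by move/perm_size: pl (leaves_gt0 t) => /= ->.
rewrite (@count_genU _ _ _ _ 1) ?muln1 -?cardE ?enum_uniq //.
  apply/allP=> y _ /=; rewrite ut count_cat addnn lJ.
  by rewrite count_uniq_mem ?enum_uniq // mem_enum inE.
move=> s ls us; apply: count_genL => //; last by rewrite ls.
by rewrite -e enum_uniq.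
Qed.

(** Double counting of networks with their drawings: a network has [2 ^ #|J|.-1] flips, each listed
    [2 ^ #|~: J|] times in [gen J]. *)
Lemma sum_gen J A : (forall N, N \in A -> tree_taxa N = J) ->
  \sum_(t <- gen J) \sum_(N in A) presents (graph N) t
  = #|A| * (2 ^ #|J|.-1 * 2 ^ #|~: J|).
Proof.
move=> AJ; rewrite exchange_big -sum_nat_const; apply: eq_bigr => N /AJ tN /=.
have [uN uuN] := drawing_valid N.
have cJ : #|J| = size (leaves (drawing N)).
  by rewrite -(card_uniqP uN) -tN; apply: eq_card => x; rewrite inE.
rewrite -count_big (eq_count (presents_drawing N)).
transitivity (\sum_(s <- flips (drawing N)) count_mem s (gen J)); last first.
  rewrite (sum_const (c := 2 ^ #|~: J|)) ?size_flips ?cJ // => s sN.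
  apply: count_gen; first exact: valid_flip sN (drawing_valid N).
  have [pl _ _ _] := flips_facts sN.
  by move=> x; rewrite (perm_mem pl) -tN inE.
under eq_bigr do rewrite count_big.
rewrite exchange_big count_big; apply: eq_bigr => t _ /=.
rewrite -count_uniq_mem ?flips_uniq // count_big; apply: eq_bigr => s _ /=.
by rewrite eq_sym.
Qed.

Lemma card_class_le J A (P : pred (tree 'I_n)) :
  (forall N, N \in A -> tree_taxa N = J) ->
  (forall N t, N \in A -> presents (graph N) t -> P t) ->
  #|A| * (2 ^ #|J|.-1 * 2 ^ #|~: J|) <= count P (gen J).
Proof.
move=> AJ AP; rewrite -(sum_gen AJ) count_big; apply: leq_sum => t _.
have [/exists_inP[N NA Nt]|] := boolP [exists N in A, presents (graph N) t].
  rewrite (bigD1 N) //= Nt (AP N t NA Nt) big1 // => M /andP[_ MN].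
  by case Mt: (presents _ _) => //; rewrite (presents_eq Mt Nt) eqxx in MN.
move=> no; rewrite big1 // => N NA; case Nt: (presents _ _) => //.
by case/exists_inP: no; exists N.
Qed.

Definition class J : {set STCN n} := [set N | tree_taxa N == J].

Lemma card_class J :
  #|class J| * (2 ^ #|J|.-1 * 2 ^ #|~: J|) = size (gen J).
Proof.
rewrite -sum_gen => [|N]; last by rewrite inE => /eqP.
rewrite size_big big_seq [RHS]big_seq; apply: eq_bigr => t /gen_valid[vt tJ].
have [N Nt] := valid_presents vt.
have NJ : N \in class J.
  rewrite inE; apply/eqP/setP=> x; rewrite inE -tJ.
  have [pl _ _ _] := flips_facts (etrans (esym (presents_drawing N t)) Nt).
  by rewrite (perm_mem pl).
rewrite (bigD1 N) //= Nt big1 // => M /andP[_ MN].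
by case Mt: (presents _ _) => //; rewrite (presents_eq Mt Nt) eqxx in MN.
Qed.

Lemma tree_taxa_gt0 N : 0 < #|tree_taxa N|.
Proof.
rewrite (_ : #|_| = size (leaves (drawing N))) ?leaves_gt0 //.
by rewrite -(card_uniqP (drawing_valid N).1); apply: eq_card => x; rewrite inE.
Qed.

End Classes.

(** With [i + 1] leaves present there are [2 i + 1] edges, each with two sides, for the next leaf.
    The product is [(2 m)! / m!]. *)
Definition sizeL m := \prod_(i < m) (4 * i + 2).

Lemma sizeL_fact m : sizeL m * m`! = (m.*2)`!.
Proof.
elim: m => [|m IHm]; first by rewrite /sizeL big_ord0.
rewrite /sizeL big_ord_recr /= -/(sizeL m) doubleS !factS -IHm; lia.
Qed.

(** The total in the shape of [count_left_height], so that the length of the word and the factorial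
    cancel in proportions. *)
Lemma sizeL_bin m : m.*2.+1 * sizeL m = m.+1`! * 'C(m.*2.+1, m.+1).
Proof.
apply/eqP; rewrite -(eqn_pmul2r (fact_gt0 m)) -mulnA sizeL_fact -factS.
rewrite -(@bin_fact m.*2.+1 m.+1); last lia.
by rewrite (_ : m.*2.+1 - m.+1 = m); [apply/eqP; lia|lia].
Qed.

Section Sizes.
Variable T : choiceType.
Implicit Types (s t : tree T) (x y : T).

Lemma nnodes_genL x xs s : s \in genL x xs -> nnodes s = (size xs).*2.+1.
Proof.
case/mem_genL=> pl us; apply: succn_inj.
by rewrite nnodesE us (perm_size pl) addn0 /= doubleS.
Qed.

Lemma size_genL x xs : size (genL x xs) = sizeL (size xs).
Proof.
elim: xs => [|y ys IHys] /=; first by rewrite /sizeL big_ord0.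
rewrite /sizeL big_ord_recr /= -/(sizeL _) -IHys size_big big_bind.
rewrite (sum_const (c := 4 * size ys + 2)) // => s /nnodes_genL es.
by rewrite sum1_size size_insL es; lia.
Qed.

Lemma size_genU_genL ys x xs :
  size (genU ys (genL x xs)) = sizeL (size xs) * rise (size xs).*2.+1 (size ys).*2.
Proof.
rewrite size_big sum_genU -(size_genL x); apply: sum_const => s /nnodes_genL es.
by rewrite sum1_size size_genU es.
Qed.

(** Skeletons of height at least [4 * a] are charged with all their insertions. For the others
    [count_depth_genU] applies with [D = 4 * a], and the factor [(size xs).+1] is the union bound
    over their leaves. *)
Lemma count_tree_height_genU ys x xs a H : uniq (x :: xs) ->
  let M := (size xs).*2.+1 in
  4 * (M + (size ys).*2) * (4 * a) <= M * H ->
  count (fun t => H <= tree_height t) (genU ys (genL x xs)) * 2 ^ (4 * a) <=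
  rise M (size ys).*2 * (count (fun s => 4 * a <= tree_height s) (genL x xs) * 2 ^ (4 * a)
    + sizeL (size xs) * (size xs).+1).
Proof.
move=> uxs M le; rewrite !count_big sum_genU -(size_genL x) (size_big (genL x xs)).
rewrite !big_distrl /= -big_split big_distrr big_seq [X in _ <= X]big_seq.
apply: leq_sum => s sin /=; have es := nnodes_genL sin.
have [pl us] := mem_genL sin.
have [_|/ltnW sle] := leqP (4 * a) (tree_height s).
  rewrite -count_big (leq_trans (leq_mul (count_size _ _) (leqnn _))) //.
  by rewrite size_genU es -/M; lia.
rewrite /= mul0n add0n mul1n.
apply: leq_trans (_ : \sum_(z <- x :: xs)
    count (fun t => H <= depth z t) (genU ys [:: s]) * 2 ^ (4 * a) <= _); last first.
  apply: leq_trans (_ : \sum_(z <- x :: xs) rise M (size ys).*2 <= _); last first.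
    by rewrite big_const_seq count_predT iter_addn_0.
  apply: leq_sum => z _; rewrite /M -es; apply: count_depth_genU; last by rewrite es.
  by apply: leq_trans sle; apply: depth_le_tree_height; rewrite (perm_uniq pl).
rewrite -big_distrl leq_mul2r; apply/orP; right => /=.
under [X in _ <= X]eq_bigr do rewrite count_big.
rewrite exchange_big big_seq [X in _ <= X]big_seq; apply: leq_sum => t tin /=.
case: (leqP H (tree_height t)) => // Ht; have [z zt zle] := tree_height_le_depth t.
have [s' + [lt _]] := mem_genU tin; rewrite inE => /eqP es'.
have zin : z \in x :: xs by rewrite -(perm_mem pl) -es' -lt.
by rewrite (big_rem z zin) /= (leq_trans Ht zle).
Qed.

End Sizes.

Lemma bin_step m a : 'C(m.*2.+1, m.+1 + a) <= 'C(m.*2.+1, m + a).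
Proof.
rewrite -(leq_pmul2l (ltn0Sn (m + a))) addSn mul_bin_left leq_mul2r; apply/orP; right; lia.
Qed.

Section Tail.
Variable n : nat.
Implicit Types (J : {set 'I_n}) (A : {set STCN n}).

Lemma cardC_ord J : #|~: J| = n - #|J|.
Proof. by rewrite [LHS]cardsCs setCK card_ord. Qed.

Lemma size_gen J : 0 < #|J| ->
  size (gen J) = sizeL #|J|.-1 * rise (#|J|.*2).-1 (n - #|J|).*2.
Proof.
rewrite cardE /gen; case e: (enum J) => [//|x xs] _.
rewrite size_genU_genL -cardE cardC_ord /=.
by rewrite [#|J|]cardE e.
Qed.

(** Both classes are counted with the same power of 2. Turning a reticulation into a tree leaf
    replaces two attachment points, [(2 j - 1) * (2 j)] choices, by one leaf insertion, [4 j - 2]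
    choices; the quotient is [j]. *)
Lemma class_succ J J' : 0 < #|J| -> #|J'| = #|J|.+1 ->
  #|class J| = #|J| * #|class J'|.
Proof.
move=> J0 eJ; have J'0 : 0 < #|J'| by rewrite eJ.
have := card_class J; have := card_class J'.
have le : #|J'| <= n by rewrite -[X in _ <= X](card_ord n) max_card.
rewrite !size_gen // !cardC_ord eJ.
case: #|J| J0 eJ le => // m _ eJ le; move: (#|class J'|) (#|class J|) => c' c /=.
rewrite eJ in le; have [k ->] : exists k, n = m + 2 + k.
  by exists (n - (m + 2)); lia.
rewrite (_ : m + 2 + k - m.+2 = k); last lia.
rewrite (_ : m + 2 + k - m.+1 = k.+1); last lia.
have -> : rise (m.+1.*2).-1 (k.+1).*2 = m.*2.+1 * m.*2.+2 * rise m.*2.+3 k.*2.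
  rewrite (_ : (k.+1).*2 = 2 + k.*2) ?rise_add; last lia.
  rewrite doubleS /= addn2; congr (_ * _).
  by rewrite /rise big_ord_recl big_ord1 /bump /= addn0 addn1.
rewrite [sizeL m.+1]big_ord_recr /= -/(sizeL m) !expnS !doubleS /= => e' e.
have p0 : 0 < 2 ^ m * (2 * 2 ^ k) by rewrite !muln_gt0 !expn_gt0.
apply/eqP; rewrite -(eqn_pmul2r p0) e; apply/eqP.
have -> : m.+1 * c' * (2 ^ m * (2 * 2 ^ k)) = m.+1 * (c' * (2 * 2 ^ m * 2 ^ k)) by lia.
rewrite e'; lia.
Qed.

(** A bound for [#|A| / #|class J|]: the proportion of tall skeletons plus the union bound. In the
    factor 4, one 2 stands for left and right, the other for the two binomials, merged by
    [bin_step]. *)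
Lemma class_tail J A a H : let j := #|J| in 0 < j ->
  A \subset class J ->
  (forall N t, N \in A -> presents (graph N) t -> H <= tree_height t) ->
  4 * (n.*2).-1 * (4 * a) <= (j.*2).-1 * H ->
  #|A| * 'C((j.*2).-1, j) * 2 ^ (4 * a) <=
  #|class J| * (4 * 'C((j.*2).-1, j.-1 + a) * 2 ^ (4 * a) + j * 'C((j.*2).-1, j)).
Proof.
move=> j j0 Asub AH le.
have AJ N : N \in A -> tree_taxa N = J.
  by move/(subsetP Asub); rewrite inE => /eqP.
have jn : j <= n by rewrite -[X in _ <= X](card_ord n) max_card.
have := card_class_le AJ AH; have := card_class J.
rewrite size_gen // -/j cardC_ord.
rewrite /gen; have cJ : j = size (enum J) by rewrite /j cardE.
case e: (enum J) cJ => [|x xs] cJ; first by rewrite cJ in j0.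
have {}cJ : j = (size xs).+1 by rewrite cJ.
have uxs : uniq (x :: xs) by rewrite -e enum_uniq.
have ys : size (enum (~: J)) = n - j by rewrite -cardE cardC_ord.
have := @count_tree_height_genU _ (enum (~: J)) x xs a H uxs.
rewrite ys /= (_ : (size xs).*2.+1 + (n - j).*2 = (n.*2).-1); last lia.
have ht_skel := count_tree_height_genL a uxs (esym cJ).
have m_j : j.-1 = size xs by rewrite cJ.
move: ht_skel le; rewrite m_j (_ : j.*2.-1 = (size xs).*2.+1); last lia.
rewrite cJ.
set m := size xs; move=> skel le /(_ le).
have := bin_step m a; have := sizeL_bin m.
set cT := count _ (genL _ _) in skel *; set cA := count _ (genU _ _).
set X := 2 ^ _ * 2 ^ _; set P := 2 ^ _; set Q := rise _ _.
set Cj := 'C(_, m.+1) in skel *; set Ca := 'C(_, m + a) in skel *.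
set Ca' := 'C(_, m.+1 + a) in skel *.
move=> sLC CaC h1 h2 h3.
have X0 : 0 < X by rewrite muln_gt0 !expn_gt0.
have cTC : cT * Cj <= 4 * Ca * sizeL m.
  rewrite -(@leq_pmul2l m.*2.+1) //.
  have -> : m.*2.+1 * (4 * Ca * sizeL m) = 4 * Ca * (m.*2.+1 * sizeL m) by lia.
  rewrite sLC mulnA; apply: leq_trans (leq_mul skel (leqnn Cj)) _.
  have -> : 4 * Ca * (m.+1`! * Cj) = 2 * (m.+1`! * (Ca + Ca)) * Cj by lia.
  by rewrite leq_mul2r; apply/orP; right; rewrite !leq_mul2l /= leq_add2l CaC orbT.
rewrite -(leq_pmul2l X0).
have -> : X * (#|A| * Cj * P) = #|A| * X * (P * Cj) by lia.
apply: leq_trans (leq_mul h3 (leqnn _)) _.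
have -> : cA * (P * Cj) = cA * P * Cj by lia.
apply: leq_trans (leq_mul h1 (leqnn _)) _.
have -> : X * (#|class J| * (4 * Ca * P + m.+1 * Cj))
   = #|class J| * X * (4 * Ca * P + m.+1 * Cj) by lia.
rewrite h2.
have -> : Q * (cT * P + sizeL m * m.+1) * Cj = Q * (cT * Cj * P + sizeL m * m.+1 * Cj) by lia.
have -> : sizeL m * Q * (4 * Ca * P + m.+1 * Cj)
  = Q * (4 * Ca * sizeL m * P + sizeL m * m.+1 * Cj) by lia.
by rewrite leq_mul2l leq_add2r leq_mul2r cTC !orbT.
Qed.

End Tail.

(** * The law of the number of tree taxa *)

Section Taxa.
Variable n : nat.
Implicit Types (J : {set 'I_n}) (A : {set STCN n}).

Definition level j : {set STCN n} := [set N | #|tree_taxa N| == j].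

Lemma card_level j : #|level j| = \sum_(J : {set 'I_n} | #|J| == j) #|class J|.
Proof.
rewrite -sum1_card (partition_big (@tree_taxa n) (fun J => #|J| == j)) /=.
  apply: eq_bigr => J /eqP cJ; rewrite -sum1_card; apply: eq_bigl => N.
  by rewrite !inE; case: (tree_taxa N =P J) => [->|_]; rewrite ?andbF // cJ eqxx.
by move=> N; rewrite inE.
Qed.

Lemma card_class_eq J J' : 0 < #|J| -> #|J| = #|J'| -> #|class J| = #|class J'|.
Proof.
move=> J0 e; have J'0 : 0 < #|J'| by rewrite -e.
have := card_class J; have := card_class J'.
rewrite !size_gen // !cardC_ord -e => <- /eqP.
by rewrite eqn_pmul2r ?muln_gt0 ?expn_gt0 // => /eqP.
Qed.

Lemma level_bin J : 0 < #|J| -> #|level #|J| | = 'C(n, #|J|) * #|class J|.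
Proof.
move=> J0; rewrite card_level.
have -> : 'C(n, #|J|) = #|[set A : {set 'I_n} | #|A| == #|J|]|.
  by rewrite card_draws card_ord.
rewrite -sum_nat_const.
apply: eq_big => [J'|J' /eqP e]; first by rewrite inE.
by apply/esym/card_class_eq.
Qed.

(** A level consists of ['C(n, j)] classes of equal size, so the quotient of consecutive levels
    combines [mul_bin_left] with [class_succ]. *)
Lemma level_succ j : 0 < j < n ->
  (n - j) * #|level j| = j.+1 * (j * #|level j.+1|).
Proof.
case/andP=> j0 jn.
have ex i : i <= n -> exists J : {set 'I_n}, #|J| = i.
  move=> le; have : 0 < #|[set J : {set 'I_n} | #|J| == i]|.
    by rewrite card_draws card_ord bin_gt0.
  by case/card_gt0P=> J; rewrite inE => /eqP; exists J.
have [J eJ] := ex j (ltnW jn); have [J' eJ'] := ex _ jn.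
have := @level_bin J; have := @level_bin J'; rewrite eJ eJ' => -> // -> //.
rewrite (@class_succ _ J J') ?eJ // mulnA -mul_bin_left; lia.
Qed.

Lemma level_grow m j : 16 * m ^ 2 <= n -> 0 < j < m ->
  4 * #|level j| <= #|level j.+1|.
Proof.
rewrite -mulnn => le /andP[j0 jm].
have jn : j < n by nia.
have := @level_succ j; rewrite j0 jn => /(_ isT) e.
have : 4 * (j * j.+1) <= n - j by nia.
move: #|level j| #|level j.+1| e => u v e h.
have p0 : 0 < j * j.+1 by rewrite muln_gt0 j0.
rewrite -(leq_pmul2l p0).
have -> : j * j.+1 * v = (n - j) * u by rewrite e; lia.
have -> : j * j.+1 * (4 * u) = 4 * (j * j.+1) * u by lia.
by rewrite leq_mul2r h orbT.
Qed.

Lemma level_le s : #|[set N : STCN n | #|tree_taxa N| <= s]|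
  = \sum_(j < s) #|level j.+1|.
Proof.
elim: s => [|s IHs].
  rewrite big_ord0; apply: eq_card0 => N; rewrite inE leqn0.
  by have := tree_taxa_gt0 N; case: #|_|.
rewrite big_ord_recr /= -IHs -cardUI.
rewrite [X in _ = _ + X]eq_card0 ?addn0; last first.
  by move=> N; rewrite !inE; lia.
by apply: eq_card => N; rewrite !inE leq_eqVlt orbC ltnS.
Qed.

(** Levels at least quadruple up to [m]. Those up to [m./2] sum to at most twice the last one, and
    the remaining steps gain [4 ^ (m - m./2) >= 2 ^ m]. *)
Lemma small_taxa m : 16 * m ^ 2 <= n ->
  #|[set N : STCN n | #|tree_taxa N| <= m./2]| * 2 ^ m <= 2 * #|{: STCN n}|.
Proof.
move=> le; rewrite level_le.
have sum_le s : 0 < s <= m -> \sum_(j < s) #|level j.+1| <= 2 * #|level s|.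
  elim: s => // s IHs /andP[_ sm]; rewrite big_ord_recr /=.
  case: s IHs sm => [|s] IHs sm; first by rewrite big_ord0; lia.
  apply: leq_trans (leq_add (IHs (ltnW sm)) (leqnn _)) _.
  rewrite [2 * #|level s.+2|]mul2n -addnn leq_add2r.
  by apply: leq_trans (level_grow le _); rewrite ?leq_mul2r ?orbT.
have grow i : i < m -> #|level (m - i)| * 4 ^ i <= #|level m|.
  elim: i => [|i IHi] im; first by rewrite subn0 muln1.
  apply: leq_trans (IHi (ltnW im)); rewrite expnS mulnA leq_mul2r; apply/orP; right.
  rewrite (_ : m - i = (m - i.+1).+1); last lia.
  by rewrite mulnC; apply: level_grow le _; lia.
have [->|m0] := posnP m./2; first by rewrite big_ord0.
have le2 : m./2 <= m by lia.
have m20 : 0 < m./2 <= m by rewrite m0.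
apply: leq_trans (leq_mul (sum_le _ m20) (leqnn _)) _.
rewrite -mulnA leq_mul2l /=.
have := grow (m - m./2); rewrite subKn // => g.
apply: leq_trans (_ : #|level m./2| * 4 ^ (m - m./2) <= _).
  by rewrite leq_mul2l -[4]/(2 ^ 2) -expnM leq_exp2l // ; apply/orP; right; lia.
by apply: leq_trans (g _) (max_card _); lia.
Qed.

Lemma Hminus_le_Hplus (N : STCN n) : Hminus N <= Hplus N.
Proof.
have stc := graph_stc N; apply/bigmax_leqP => v lv.
apply: leq_trans (leq_bigmax_cond _ lv).
have [rp _] := height_minP stc v; have [_ mx] := height_maxP stc v.
exact: mx.
Qed.

Lemma Hplus_le (N : STCN n) : Hplus N <= 4 * n.
Proof.
apply/bigmax_leqP => v _; apply/bigmax_leqP => k _.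
by apply: leq_trans (ltnW (ltn_ord k)) _; rewrite card_ord -ltnS.
Qed.

Lemma Hplus_drawing (N : STCN n) t : presents (graph N) t -> Hplus N <= (tree_height t).+1.
Proof. exact: longer_height_pres (graph_stc N) _. Qed.

End Taxa.

(** * The tail estimate *)

Local Open Scope ring_scope.

Section Analysis.
Variable R : realType.
Implicit Types (x y : R).

(** The quotient of consecutive binomials, [(m + 1 - a) / (m + 1 + a)], is at most
    [1 - a / (m + 1)]; the exponents add up to [a (a - 1) / 2] over [m + 1]. *)
Lemma bin_decay m a :
  'C(m.*2.+1, m + a)%:R <=
  'C(m.*2.+1, m.+1)%:R * expR (- (a%:R * (a%:R - 1) / 2 / m.+1%:R)) :> R.
Proof.
elim: a => [|a IHa].
  rewrite addn0 !mul0r oppr0 expR0 mulr1 ler_nat.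
  by rewrite -[leqLHS]bin_sub ?leq_addr //; [rewrite (_ : m.*2.+1 - m = m.+1)%N //; lia|lia].
have m0 : 0 < m.+1%:R :> R by rewrite ltr0n.
have step : 'C(m.*2.+1, m + a.+1)%:R <= 'C(m.*2.+1, m + a)%:R * expR (- (a%:R / m.+1%:R)) :> R.
  have e : (m + a.+1)%:R * 'C(m.*2.+1, m + a.+1)%:R
      = (m.+1 - a)%:R * 'C(m.*2.+1, m + a)%:R :> R.
    rewrite -!natrM; congr (_%:R); rewrite addnS mul_bin_left.
    by congr (_ * _)%N; lia.
  have B0 : 0 <= 'C(m.*2.+1, m + a)%:R :> R by rewrite ler0n.
  have le1 : (m.+1 - a)%:R / m.+1%:R <= expR (- (a%:R / m.+1%:R)) :> R.
    have [am|/ltnW am] := leqP a m.+1; last first.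
      by rewrite (eqP (am : (m.+1 - a == 0)%N)) mul0r expR_ge0.
    apply: le_trans (expR_ge1Dx _); rewrite natrB // mulrBl divff ?gt_eqF //.
  rewrite mulrC; apply: le_trans (ler_wpM2r B0 le1).
  rewrite mulrAC ler_pdivlMr // -e mulrC ler_wpM2r ?ler0n // ler_nat.
  by rewrite addnS ltnS leq_addr.
apply: le_trans step _; apply: le_trans (ler_wpM2r (expR_ge0 _) IHa) _.
rewrite -[leLHS]mulrA -expRD le_eqVlt; apply/orP; left; apply/eqP; congr (_ * expR _).
by rewrite -[a.+1%:R]natr1; field; rewrite -natr1 in m0 *; lra.
Qed.

Lemma half_pow_le k : 2^-1 ^+ k <= expR (- (k%:R / 2)) :> R.
Proof.
have e : 2^-1 <= expR (- (2^-1)) :> R.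
  by apply: le_trans (expR_ge1Dx _); lra.
have -> : - (k%:R / 2) = k%:R * - (2^-1) :> R by rewrite mulrN.
by rewrite expRM_natl; apply: lerXn2r; rewrite ?nnegrE ?expR_ge0 // invr_ge0 ler0n.
Qed.


Lemma sqr_le_four_pow b : (b ^ 2 <= 4 ^ b)%N.
Proof.
by rewrite -[4%N]/(2 ^ 2)%N -expnM mulnC expnM leq_exp2r // ltnW // ltn_expl.
Qed.

(** [y] stands for [n^(1/4)], and the last hypothesis makes [a + 1] of order at least [j x / y]. Its
    square yields [64 * 64]; the 32 is the 8 of the bound on [y ^+ 2] times the 4 in
    [b ^+ 2 / 4]. *)
Lemma tail_estimate a x y j :
  1 <= x -> x <= 4 * y -> 1 <= j -> y ^+ 2 <= 8 * j ->
  j * x <= 64 * y * a.+1%:R ->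
  4 * expR (- (a%:R * (a%:R - 1) / 2 / j)) + j * 2^-1 ^+ (4 * a)
  <= (4 * expR 2 + (128 * (64 * 64))) * expR (- (x ^+ 2 / (32 * (64 * 64)))).
Proof.
move=> x1 xy j1 yj; set b : R := a.+1%:R => jx.
have y0 : 0 < y by lra.
have j0 : 0 < j by lra.
have ab : a%:R = b - 1 :> R by rewrite /b -natr1 addrK.
have b0 : 0 < b by rewrite ltr0n.
have jx2 : (j * x) ^+ 2 <= (64 * y * b) ^+ 2.
  by rewrite lerXn2r ?nnegrE // ?mulr_ge0 //; lra.
have bj : j * x ^+ 2 <= (8 * (64 * 64)) * b ^+ 2.
  rewrite -(ler_pM2l j0); have -> : j * (j * x ^+ 2) = (j * x) ^+ 2 by ring.
  apply: le_trans jx2 _.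
  have -> : (64 * y * b) ^+ 2 = (64 * 64) * b ^+ 2 * y ^+ 2 by ring.
  have -> : j * ((8 * (64 * 64)) * b ^+ 2) = (64 * 64) * b ^+ 2 * (8 * j) by ring.
  by apply: ler_wpM2l => //; rewrite mulr_ge0 // sqr_ge0.
(* The union bound decays only exponentially in [b], so [x <= 4 * y] is used to trade a factor [y]
   for a second factor [x]. *)
have x2 : x ^+ 2 <= (32 * 64) * b.
  have h : y * (8 * j) * x <= 8 * (64 * y * b) * y by nra.
  have h2 : y ^+ 2 * x <= (8 * 64) * y * b by nra.
  have h3 : y * x <= (8 * 64) * b.
    rewrite -(ler_pM2l y0); have -> : y * (y * x) = y ^+ 2 * x by ring.
    by apply: le_trans h2 _; rewrite le_eqVlt; apply/orP; left; apply/eqP; ring.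
  nra.
have jb : j <= (8 * (64 * 64)) * b ^+ 2.
  by apply: le_trans bj; rewrite ler_peMr ?expr_ge1 //; lra.
rewrite [leRHS]mulrDl; apply: lerD.
  rewrite -[leRHS]mulrA -expRD; apply: ler_wpM2l => //; rewrite ler_expR.
  suff : x ^+ 2 / (32 * (64 * 64)) <= b ^+ 2 / 4 / j.
    (* Replacing [a * (a - 1) / 2] by [b ^+ 2 / 4] loses at most [5 / 4]; this is the origin of the
       factor [expR 2]. *)
    have : b ^+ 2 / 4 / j - 2 <= a%:R * (a%:R - 1) / 2 / j.
      have h : (b ^+ 2 / 4 - 5 / 4) / j <= a%:R * (a%:R - 1) / 2 / j.
        apply: ler_wpM2r; first by rewrite invr_ge0; lra.
        by rewrite ab; have := sqr_ge0 (b / 2 - 3 / 2); lra.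
      have h2 : 5 / 4 / j <= 2 by rewrite ler_pdivrMr //; lra.
      by move: h; rewrite mulrBl; lra.
    lra.
  rewrite ler_pdivlMr // ; lra.
have -> : j * 2^-1 ^+ (4 * a) = 16 * j * 2^-1 ^+ (4 * a.+1) :> R.
  by rewrite mulnS exprD; field.
(* Half of the power of 2 absorbs [j], which is at most a multiple of [b ^+ 2]; the other half gives
   the decay in [x]. *)
apply: (@le_trans _ _ ((128 * (64 * 64)) * 2^-1 ^+ (2 * a.+1))).
  have e : b ^+ 2 * 2^-1 ^+ (2 * a.+1) <= 1 :> R.
    rewrite exprVn ler_pdivrMr ?exprn_gt0 // mul1r exprM -natrX -natrX -natrX ler_nat.
    exact: sqr_le_four_pow.
  rewrite (_ : (4 * a.+1 = 2 * a.+1 + 2 * a.+1)%N); last by rewrite -mulnDl.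
  rewrite exprD [leLHS]mulrA; apply: ler_wpM2r; first by rewrite exprn_ge0 ?invr_ge0.
  apply: (@le_trans _ _ (16 * ((8 * (64 * 64)) * b ^+ 2) * 2^-1 ^+ (2 * a.+1))); last by lra.
  by apply: ler_wpM2r; [rewrite exprn_ge0 ?invr_ge0|lra].
apply: ler_wpM2l; first lra.
apply: le_trans (half_pow_le _) _; rewrite ler_expR natrM -/b; lra.
Qed.

Lemma class_tail_real n (J : {set 'I_n}) (A : {set STCN n}) a H :
  (0 < #|J|)%N -> A \subset class J ->
  (forall N t, N \in A -> presents (graph N) t -> (H <= tree_height t)%N) ->
  (4 * (n.*2).-1 * (4 * a) <= (#|J|.*2).-1 * H)%N ->
  #|A|%:R <= #|class J|%:R * (4 * expR (- (a%:R * (a%:R - 1) / 2 / #|J|%:R))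
    + #|J|%:R * 2^-1 ^+ (4 * a)) :> R.
Proof.
move=> J0 Asub AH le; have := class_tail J0 Asub AH le.
case: #|J| J0 {le} => // m _; rewrite doubleS /= => le.
have C0 : 0 < 'C(m.*2.+1, m.+1)%:R :> R by rewrite ltr0n bin_gt0; lia.
have P0 : 0 < 2 ^+ (4 * a) :> R by rewrite exprn_gt0.
have h := bin_decay m a; set E := expR _ in h *.
rewrite -(ler_pM2r P0) -(ler_pM2r C0).
apply: (@le_trans _ _ (#|class J| * (4 * 'C(m.*2.+1, m + a) * 2 ^ (4 * a) +
   m.+1 * 'C(m.*2.+1, m.+1)))%N%:R).
  by rewrite -natrX -!natrM ler_nat mulnAC.
rewrite !natrM natrD !natrM natrX exprVn.
move: h C0 P0; set B := 'C(_, m + a)%:R; set C := 'C(_, _)%:R; set P := 2 ^+ _ => h C0 P0.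
rewrite -!(mulrA #|class J|%:R); apply: ler_wpM2l => //.
have -> : (4 * E + m.+1%:R * P^-1) * P * C = 4 * (C * E) * P + m.+1%:R * C.
  by field; rewrite gt_eqF.
by apply: lerD => //; apply: ler_wpM2r; [apply: ltW|apply: ler_wpM2l].
Qed.

End Analysis.

Lemma quarter_sqrt n : exists m, (16 * m ^ 2 <= n < 16 * m.+1 ^ 2)%N.
Proof.
have ex : exists m, (16 * m ^ 2 <= n)%N by exists 0%N.
have ub m : (16 * m ^ 2 <= n)%N -> (m <= n)%N.
  by rewrite -mulnn; case: m => // m; nia.
have [m le mx] := ex_maxnP ex ub; exists m; rewrite le ltnNge.
by apply/negP=> /mx; rewrite ltnn.
Qed.

Lemma exponent_choice n j H : (0 < j <= n)%N ->
  exists a, (4 * (n.*2).-1 * (4 * a) <= (j.*2).-1 * H)%N /\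
    (j * H <= 32 * n * a.+1)%N.
Proof.
case/andP=> j0 jn; set M := (j.*2).-1; set D := (16 * (n.*2).-1)%N.
have D0 : (0 < D)%N by rewrite muln_gt0 /=; lia.
exists (M * H %/ D)%N; split.
  by apply: leq_trans (leq_trunc_div (M * H) D); rewrite /D; lia.
have := ltn_ceil (M * H) D0; move: (M * H %/ D)%N => a lt.
have n0 : (0 < (n.*2).-1)%N by lia.
rewrite -(leq_pmul2l n0).
have e1 : ((n.*2).-1 * (j * H) <= 2 * n * (M * H))%N.
  rewrite mulnA [X in (_ <= X)%N]mulnA leq_mul2r; apply/orP; right.
  by rewrite /M; nia.
apply: leq_trans e1 _; apply: leq_trans (leq_mul (leqnn _) (ltnW lt)) _.
by rewrite /D; nia.
Qed.

Section Bound.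
Variable R : realType.
Implicit Types (x y : R).

Let C1 : R := 4 * expR 2 + 128 * (64 * 64).
Let E x : R := expR (- (x ^+ 2 / (32 * (64 * 64)))).

Lemma class_bound n (J : {set 'I_n}) (A : {set STCN n}) x y :
  y ^+ 4 = n%:R -> 1 <= x -> x <= 4 * y -> y ^+ 2 <= 8 * #|J|%:R ->
  (0 < #|J|)%N -> A \subset class J ->
  (forall N, N \in A -> x * y ^+ 3 <= (Hplus N)%:R) ->
  #|A|%:R <= #|class J|%:R * (C1 * E x).
Proof.
move=> yn x1 xy yj J0 Asub AH.
have y0 : 0 < y by lra.
have jn : (#|J| <= n)%N by rewrite -[leqRHS](card_ord n) max_card.
(* Half of the required height is enough for the drawing: [Hplus N <= tree_height t + 1 <= 2 *
   tree_height t] pays for the root arc. *)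
have ex : exists k : nat, x * y ^+ 3 / 2 <= k%:R.
  exists (Num.bound (x * y ^+ 3 / 2)); apply/ltW/archi_boundP.
  by rewrite divr_ge0 // mulr_ge0 ?exprn_ge0; lra.
have [H Hge Hmin] := ex_minnP ex.
have [|a [le1 le2]] := @exponent_choice n #|J| H; first by rewrite J0.
apply: le_trans (class_tail_real R J0 Asub _ le1) _ => [N t NA Nt|].
  apply: Hmin; rewrite ler_pdivrMr //; apply: le_trans (AH N NA) _.
  rewrite -natrM ler_nat; apply: leq_trans (Hplus_drawing Nt) _.
  by rewrite muln2 -addnn -addn1 leq_add2l tree_height_gt0.
apply: ler_wpM2l => //; apply: (tail_estimate x1 xy) => //.
  by rewrite (ler_nat R 1).
have h : #|J|%:R * H%:R <= 32 * y ^+ 4 * a.+1%:R :> R.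
  by rewrite yn -!natrM ler_nat.
have y3 : 0 < y ^+ 3 by rewrite exprn_gt0.
rewrite -(ler_pM2r y3).
have -> : 64 * y * a.+1%:R * y ^+ 3 = 2 * (32 * y ^+ 4 * a.+1%:R) by ring.
have j0 : 0 <= #|J|%:R :> R by [].
have := ler_wpM2l j0 Hge; lra.
Qed.

Lemma tall_bound n x y (A : {set STCN n}) : (0 < n)%N ->
  y ^+ 4 = n%:R -> 0 < y -> 1 <= x ->
  (forall N, N \in A -> x * y ^+ 3 <= (Hplus N)%:R) ->
  #|A|%:R <= (C1 + 4) * E x * #|{: STCN n}|%:R.
Proof.
move=> n0 yn y0 x1 AH.
have C10 : 0 <= C1 by rewrite /C1; have := expR_ge0 (2 : R); lra.
have E0 : 0 <= E x := expR_ge0 _.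
(* A single member of [A] forces [x <= 4 * y], since heights are at most [4 * n]. *)
have [->|[N0 N0A]] := set_0Vmem A.
  by rewrite cards0 !mulr_ge0 // addr_ge0.
have y3 : 0 < y ^+ 3 by rewrite exprn_gt0.
have xy : x <= 4 * y.
  rewrite -(ler_pM2r y3) -mulrA -exprS yn; apply: le_trans (AH _ N0A) _.
  by rewrite -natrM ler_nat Hplus_le.
have [m /andP[m_le m_gt]] := quarter_sqrt n.
have ym : y ^+ 2 <= 4 * m.+1%:R.
  rewrite -(@ler_pXn2r _ 2) ?nnegrE ?exprn_ge0 ?mulr_ge0 //; last exact: ltW.
  by rewrite -exprM yn exprMn -!natrX -natrM ler_nat ltnW.
have small : #|[set N : STCN n | #|tree_taxa N| <= m./2]|%N%:R
    <= 4 * E x * #|{: STCN n}|%:R :> R.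
  have p0 : 0 < 2 ^+ m :> R by rewrite exprn_gt0.
  rewrite -(ler_pM2r p0) -natrX -natrM.
  apply: (@le_trans _ _ (2 * #|{: STCN n}|)%N%:R); first by rewrite ler_nat small_taxa.
  (* As [x ^+ 2 <= 16 * y ^+ 2 <= 64 * m.+1], the exponent of [E x] is at most [m.+1 / 2] in
     absolute value; then [half_pow_le] applies. *)
  have h : 2 <= 4 * E x * 2 ^+ m.
    have := half_pow_le R m.+1; rewrite exprVn exprS invfM => h.
    have h2 : expR (- (m.+1%:R / 2)) <= E x.
      rewrite ler_expR lerN2; have m1 : 0 <= m.+1%:R :> R by [].
      have : x ^+ 2 <= 16 * y ^+ 2.
        by rewrite -[16](_ : 4 ^+ 2 = _) -?exprMn ?lerXn2r ?nnegrE //; [lra|lra|ring].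
      lra.
    have h3 := le_trans h h2.
    rewrite -ler_pdivrMr //; lra.
  rewrite natrM natrX mulrAC; apply: ler_wpM2r => //.
apply: (@le_trans _ _ (#|[set N : STCN n | #|tree_taxa N| <= m./2]|%N%:R +
    \sum_(J : {set 'I_n} | (m./2 < #|J|)%N) #|A :&: class J|%:R)).
  rewrite -natr_sum -natrD ler_nat.
  rewrite -(cardsID [set N : STCN n | #|tree_taxa N| <= m./2]%N A).
  apply: leq_add; first exact/subset_leq_card/subsetIr.
  rewrite -sum1_card (partition_big (@tree_taxa n) (fun J => (m./2 < #|J|)%N)) /=.
    apply: leq_sum => J _; rewrite sum1_card; apply/subset_leq_card/subsetP=> N.
    by rewrite !inE unfold_in => /andP[/setDP[-> _] ->].
  by move=> N; rewrite !inE -ltnNge => /andP[].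
rewrite [leRHS](_ : _ = 4 * E x * #|{: STCN n}|%:R + #|{: STCN n}|%:R * (C1 * E x));
  last by ring.
apply: lerD => //.
apply: (@le_trans _ _ (\sum_(J : {set 'I_n} | (m./2 < #|J|)%N) #|class J|%:R * (C1 * E x))).
  apply: ler_sum => J mJ; apply: (@class_bound _ _ _ x y) => //.
  - have : (m.+1 <= 2 * #|J|)%N by move: mJ; clear; lia.
    by rewrite -(ler_nat R) natrM; lra.
  - exact: leq_ltn_trans mJ.
  - exact: subsetIr.
  - by move=> N; rewrite inE => /andP[/AH].
rewrite -mulr_suml; apply: ler_wpM2r; first by rewrite mulr_ge0.
rewrite -natr_sum ler_nat -[leqRHS]sum1_card (partition_big (@tree_taxa n) predT) //=.
rewrite big_mkcond /=; apply: leq_sum => J _; case: ifP => // _.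
by rewrite -sum1_card; apply: eq_leq; apply: eq_bigl => N; rewrite inE.
Qed.

End Bound.

Theorem theorem1p3 (R : realType) :
  exists C c : R, 0 < C /\ 0 < c /\
    forall (n : nat) (x : R), (1 <= n)%N -> 0 <= x ->
      uniform_prob R [set N : STCN n | x * n%:R `^ (3 / 4) <= (Hminus N)%:R]
        <= uniform_prob R [set N : STCN n | x * n%:R `^ (3 / 4) <= (Hplus N)%:R]
        <= C * expR (- c * x ^+ 2).
Proof.
exists (4 * expR 2 + 128 * (64 * 64) + 4), (32 * (64 * 64))^-1.
have e2 := expR_gt0 (2 : R).
split; first by lra.
split; first by rewrite invr_gt0; lra.
move=> n x n1 x0; apply/andP; split.
  rewrite ler_wpM2r ?invr_ge0 ?ler0n // ler_nat; apply/subset_leq_card/subsetP=> N.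
  by rewrite !inE => h; apply: le_trans h _; rewrite ler_nat Hminus_le_Hplus.
set A := [set N | _].
have -> : - (32 * (64 * 64))^-1 * x ^+ 2 = - (x ^+ 2 / (32 * (64 * 64))).
  by rewrite mulNr mulrC.
(* For [x < 1] the right-hand side is at least 1, because the constant in front is large. *)
have [x1|x1] := leP 1 x; last first.
  apply: (@le_trans _ _ 1).
    rewrite /uniform_prob; have [->|T0] := posnP #|{: STCN n}|; first by rewrite invr0 mulr0.
    by rewrite ler_pdivrMr ?ltr0n // mul1r ler_nat max_card.
  have := expR_ge1Dx (- (x ^+ 2 / (32 * (64 * 64)))).
  have : x ^+ 2 <= 1 by rewrite expr_le1 // ltW.
  nra.
have [T0|T0] := posnP #|{: STCN n}|.
  by rewrite /uniform_prob T0 invr0 mulr0 mulr_ge0 ?expR_ge0 //; lra.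
rewrite /uniform_prob ler_pdivrMr ?ltr0n //.
(* With [y = n^(1/4)] the scale of the statement is [y ^+ 3], and the estimates need only integer
   powers of [y]. *)
apply: (@tall_bound R n x (n%:R `^ (1 / 4))) => //.
- by rewrite -powR_mulrn ?powR_ge0 // -powRrM (_ : 1 / 4 * 4 = 1) ?powRr1 //; lra.
- by rewrite powR_gt0 // ltr0n.
- move=> N; rewrite inE -powR_mulrn ?powR_ge0 // -powRrM.
  by rewrite (_ : 1 / 4 * 3 = 3 / 4) //; lra.
Qed.
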